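(* Let $W$ be a non-negative random variable with $0<\mathbb{E}[W]<\infty$, and let $G_n=\mathrm{IRG}_n(W)$, $n\ge 1$, be the sequence of rank-1 inhomogeneous random graphs with weight distribution $W$. Let $o_n$ be a uniformly chosen vertex of $G_n$ and assume that $(d_{o_n}^2)_{n\ge 1}$ is uniformly integrable. Then for every integer $k\ge 1$, $$\Phi_{G_n}(k)\ \xrightarrow{\ \mathbb{P}\ }\ 1+\frac{\mathbb{E}[W^2]}{\mathbb{E}[W]}\qquad (n\to\infty).$$
   Context: Rank-1 inhomogeneous random graph: $\mathrm{IRG}_n(W)$ has vertex set $\{1,\dots,n\}$; let $W_1,\dots,W_n$ be i.i.d. copies of $W$, and, given these, connect each pair $i\neq j$ independently with probability $$p_{ij}=\min\left\{\frac{W_iW_j}{n\,\mathbb{E}[W]},\,1\right\}.$$ $d_v$ denotes the degree of vertex $v$. For a graph $G$, $\vec{E}(G)$ is the set of ordered pairs $(u,v)$ with $\{u,v\}\in E(G)$, and $\sum_{u\to v}$ denotes summation over $(u,v)\in\vec{E}(G)$. Uniform integrability is with respect to the joint randomness of $G_n$ and $o_n$. Average nearest neighbour degree (ANND) of a finite graph $G$: let $f_G(k)=\frac{1}{|V(G)|}\sum_{v\in V(G)}\mathbf{1}_{\{d_v=k\}}$, $f^*_G(k)=\frac{1}{|\vec{E}(G)|}\sum_{u\to v}\mathbf{1}_{\{d_u=k\}}$ and $h_G(k,\ell)=\frac{1}{|\vec{E}(G)|}\sum_{u\to v}\mathbf{1}_{\{d_u=k,\,d_v=\ell\}}$. For $k=1,2,\dots$,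 $$\Phi_G(k)=\mathbf{1}_{\{f_G(k)>0\}}\frac{\sum_{\ell>0}\ell\,h_G(k,\ell)}{f^*_G(k)},$$ interpreted as $0$ when $f_G(k)=0$. *)

(* Defs.v *)
From HB Require Import structures.
From mathcomp Require Import all_boot all_order all_algebra.
From mathcomp Require Import all_classical all_reals all_analysis.

Set Implicit Arguments.
Unset Strict Implicit.
Unset Printing Implicit Defensive.

Import Order.TTheory GRing.Theory Num.Theory.
Import numFieldNormedType.Exports.

Local Open Scope classical_set_scope.
Local Open Scope ring_scope.

(* A finite simple graph on V is represented by its set of ordered adjacent
   pairs, so that [arcs G] is the set \vec E(G). *)
Definition simple_arcs (V : finType) (A : {set V * V}) : bool :=
  [forall u, (u, u) \notin A] &&
  [forall u, forall v, ((u, v) \in A) ==> ((v, u) \in A)].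

Record sgraph (V : finType) := SGraph {
  arcs : {set V * V};
  arcsP : simple_arcs arcs
}.

HB.instance Definition _ (V : finType) := [isSub for @arcs V].
HB.instance Definition _ (V : finType) := [Finite of sgraph V by <:].

Definition degree (V : finType) (G : sgraph V) (v : V) : nat :=
  #|[pred u | (v, u) \in arcs G]|.

Definition degree_freq (R : realType) (V : finType) (G : sgraph V) (k : nat)
    : R :=
  #|V|%:R^-1 * \sum_(v : V) (degree G v == k)%:R.

Definition arc_degree_freq (R : realType) (V : finType) (G : sgraph V)
    (k : nat) : R :=
  #|arcs G|%:R^-1 * \sum_(e in arcs G) (degree G e.1 == k)%:R.

Definition arc_joint_degree_freq (R : realType) (V : finType) (G : sgraph V)
    (k l : nat) : R :=
  #|arcs G|%:R^-1 *
  \sum_(e in arcs G) ((degree G e.1 == k) && (degree G e.2 == l))%:R.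

Lemma degree_lt_card (V : finType) (G : sgraph V) (v : V) :
  (degree G v < #|V|)%N.
Proof.
apply/proper_card/properP; split; first exact/fintype.subsetP.
exists v; rewrite // inE.
by have /andP[/forallP/(_ v)] := arcsP G.
Qed.

Lemma arc_joint_degree_freq_eq0 (R : realType) (V : finType) (G : sgraph V)
    (k l : nat) :
  (#|V| <= l)%N -> arc_joint_degree_freq R G k l = 0.
Proof.
move=> Vl; rewrite /arc_joint_degree_freq big1 ?mulr0// => e _.
by rewrite (ltn_eqF (leq_trans (degree_lt_card G e.2) Vl)) andbF.
Qed.

(* The average nearest neighbour degree.  The sum over all l > 0 is cut at
   #|V|, beyond which its terms vanish ([arc_joint_degree_freq_eq0]).  When
   [degree_freq R G k = 0] the value is 0. *)
Definition annd (R : realType) (V : finType) (G : sgraph V) (k : nat) : R :=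
  (0 < degree_freq R G k)%R%:R *
  ((\sum_(1 <= l < #|V|) l%:R * arc_joint_degree_freq R G k l) /
   arc_degree_freq R G k).

Definition mutually_independent (R : realType) (d : measure_display)
    (T : measurableType d) (P : probability T R) (I : finType)
    (X : I -> {RV P >-> R}) : Prop :=
  forall (J : {set I}) (B : I -> set R), (forall i, measurable (B i)) ->
    P (\bigcap_(i in [set` J]) (X i @^-1` B i)) =
    (\prod_(i in J) P (X i @^-1` B i))%E.

(* The copies may live on another probability space than the original. *)
Definition iid_copies (R : realType) (d0 d : measure_display)
    (T0 : measurableType d0) (P0 : probability T0 R) (W : {RV P0 >-> R})
    (T : measurableType d) (P : probability T R) (I : finType)
    (X : I -> {RV P >-> R}) : Prop :=
  mutually_independent X /\
  forall i (B : set R), measurable B ->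
    distribution P (X i) B = distribution P0 W B.

Definition irg_edge_prob (R : realType) (n : nat) (m : R) (w : 'I_n -> R)
    (i j : 'I_n) : R :=
  Num.min (w i * w j / (n%:R * m)) 1.

(* Probability that the random graph is [g] when the pairs {i, j} are joined
   independently, with probability [p i j] for i < j. *)
Definition independent_edges_pmf (R : realType) (n : nat) (p : 'I_n -> 'I_n -> R)
    (g : sgraph 'I_n) : R :=
  \prod_(e : 'I_n * 'I_n | (e.1 < e.2)%N)
    (if e \in arcs g then p e.1 e.2 else 1 - p e.1 e.2).

Definition measurable_discrete (d : measure_display) (T : measurableType d)
    (S : finType) (X : T -> S) : Prop :=
  forall s, measurable (X @^-1` [set s]).

(* [G] is a sample of IRG_n(W): there are i.i.d. copies w_1, ..., w_n of W such
   that the conditional probability of the event G = g given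
   sigma(w_1, ..., w_n) is the independent-edges probability of g, for
   every g. *)
Definition is_irg (R : realType) (d0 d : measure_display)
    (T0 : measurableType d0) (P0 : probability T0 R) (W : {RV P0 >-> R})
    (T : measurableType d) (P : probability T R) (n : nat)
    (G : T -> sgraph 'I_n) : Prop :=
  measurable_discrete G /\
  exists2 w : 'I_n -> {RV P >-> R}, iid_copies W w &
    forall (g : sgraph 'I_n) (A : set T),
      g_sigma_preimage (fun i => w i : T -> R) A ->
      P (A `&` G @^-1` [set g]) =
      (\int[P]_(x in A)
         (independent_edges_pmf
            (irg_edge_prob (fine 'E_P0[W]) (fun i => w i x)) g)%:E)%E.

Definition is_uniform_vertex (R : realType) (d : measure_display)
    (T : measurableType d) (P : probability T R) (V : finType)
    (G : T -> sgraph V) (o : T -> V) : Prop :=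
  measurable_discrete o /\
  forall (g : sgraph V) (v : V),
    P (G @^-1` [set g] `&` o @^-1` [set v]) =
    ((#|V|%:R^-1)%:E * P (G @^-1` [set g]))%E.

(* The members of the sequence may live on different probability spaces. *)
Definition uniformly_integrable (R : realType) (d : nat -> measure_display)
    (T : forall n, measurableType (d n)) (P : forall n, probability (T n) R)
    (X : forall n, T n -> R) : Prop :=
  (forall n, measurable_fun setT (X n)) /\
  (ereal_sup (range (fun n =>
     \int[P n]_(x in [set x | (K < `|X n x|)%R]) (`|X n x|)%:E)) @[K --> +oo%R]
   --> 0)%E.

Definition cvg_in_probability (R : realType) (d : nat -> measure_display)
    (T : forall n, measurableType (d n)) (P : forall n, probability (T n) R)
    (X : forall n, T n -> R) (c : R) : Prop :=
  forall e : R, 0 < e ->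
    (P n [set x | (e < `|X n x - c|)%R] @[n --> \oo] --> 0)%E.

(* Main.v *)
From HB Require Import structures.
Require Import Defs.
From mathcomp Require Import all_boot all_order all_algebra.
From mathcomp Require Import all_classical all_reals all_analysis.
From mathcomp Require Import measurable_realfun.
From mathcomp Require Import ring lra zify.
Import Order.TTheory GRing.Theory Num.Theory.
Import numFieldNormedType.Exports.

(* The pair counts N(k,l) = #{u -> v : d_u = k, d_v = l} satisfy
   N(k,l)/n -> a_k a_l / m in L1, where m = E[W] and
   a_k = E[W P(Poisson(W) = k-1)] = k P(Poisson(W) = k).  Given the weights,
   N(k,l) changes by at most 2(k+l) when one edge is flipped, so its variance is
   O(n) (Efron-Stein), and for the same reason replacing the edge probabilities
   by v_i v_j/(n m) with truncated weights v = W 1{W <= K} costs at most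
   2(k+l) times the sum of their differences.  For truncated weights the
   conditional mean of N(k,l) is explicit up to Poisson approximation, and the
   weak law of large numbers gives its limit; then K -> oo.

   Uniform integrability of d^2 bounds the pairs with d_v > L uniformly in n, so
   numerator and denominator of the ANND converge in L1 to
   (a_k / m) sum_l l a_l and (a_k / m) sum_l a_l, whose ratio is
   (E[W] + E[W^2]) / E[W].  It also bounds sum_l l a_l, whence E[W^2] < oo. *)

Set Implicit Arguments.
Unset Strict Implicit.
Unset Printing Implicit Defensive.
Local Open Scope ring_scope.

(** * Random subsets *)

(** Until the last part only E[W] < oo is available, so the estimates on the pair counts must get by
    with first moments. They can because weights at distinct vertices are independent: the sum of
    w_i w_j over i != j has mean at most n^2 E[W]^2, and squares of weights are met only after
    truncation. Truncation makes each edge probability at most K^2/(n m), so the squared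
    probabilities at one vertex sum to O(1/n), as the Poisson approximation requires. The truncated
    probabilities keep the denominator n m, hence the Poisson rates carry a factor c =
    E[W 1{W <= K}]/m, which tends to 1 only as K -> oo. The [1 +] in the limit is the arc through
    which a neighbour is reached: l + 1 averaged over Poisson(x) is 1 + x, so the weighted series of
    the a_l is E[W (1 + W)]. This holds in the extended reals, before E[W^2] is known to be finite.
    Averages given the weights and averages over graphs are finite sums, so measure theory enters
    only through the laws of the weights and of the sampled graph and vertex. *)

Section RandomSubset.
Variables (R : realFieldType) (E : finType).
Implicit Types (p q : E -> R) (s : seq E) (e : E) (A S : {set E})
  (f g : {set E} -> R).

(** Expectation of [f] at a random subset of [s] that contains each [e] independently with
    probability [p e]. The recursion makes linearity, independence and conditioning algebraic
    identities, valid for arbitrary [p]; the bounds 0 <= p <= 1 enter only with inequalities. *)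
Fixpoint mean p s f : R :=
  if s is e :: s' then
    p e * mean p s' (fun A => f (e |: A)%SET) + (1 - p e) * mean p s' f
  else f finset.set0.

Definition ignores e f := forall A, f (e |: A)%SET = f A.

Lemma eq_mean p s f g : f =1 g -> mean p s f = mean p s g.
Proof.
elim: s f g => [|e s IHs] f g fg /=; first exact: fg.
by rewrite (IHs _ _ fg) (IHs _ (fun A => g (e |: A)%SET)).
Qed.

Lemma mean_cst p s (c : R) : mean p s (fun=> c) = c.
Proof. by elim: s => //= e s ->; ring. Qed.

Lemma meanD p s f g : mean p s (fun A => f A + g A) = mean p s f + mean p s g.
Proof. by elim: s f g => //= e s IHs f g; rewrite !IHs; ring. Qed.

Lemma meanZ p s (c : R) f : mean p s (fun A => c * f A) = c * mean p s f.
Proof. by elim: s f => //= e s IHs f; rewrite !IHs; ring. Qed.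

Lemma meanB p s f g : mean p s (fun A => f A - g A) = mean p s f - mean p s g.
Proof. by elim: s f g => //= e s IHs f g; rewrite !IHs; ring. Qed.

Lemma mean_sum p s (I : Type) (r : seq I) (P : pred I) (F : I -> {set E} -> R) :
  mean p s (fun A => \sum_(i <- r | P i) F i A) =
  \sum_(i <- r | P i) mean p s (F i).
Proof.
elim: r => [|i r IHr].
  rewrite big_nil -[RHS](mean_cst p s); apply: eq_mean => A.
  by rewrite big_nil.
rewrite big_cons -IHr; case: ifPn => Pi.
  by rewrite -meanD; apply: eq_mean => A; rewrite big_cons Pi.
by apply: eq_mean => A; rewrite big_cons (negbTE Pi).
Qed.

Lemma ignores_setU1 e e' f :
  ignores e f -> ignores e (fun A => f (e' |: A)%SET).
Proof. by move=> fe A; rewrite finset.setUCA fe. Qed.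

Lemma ignores_add e f : ignores e (fun A => f (e |: A)%SET).
Proof. by move=> A; rewrite finset.setUA finset.setUid. Qed.

(** Each element influences at most one of the two factors. So at each step of the recursion one
    factor is the same in both branches and can be pulled out. *)
Lemma mean_indep p s f g :
  {in s, forall e, ignores e f \/ ignores e g} ->
  mean p s (fun A => f A * g A) = mean p s f * mean p s g.
Proof.
elim: s f g => [|e s IHs] //= f g fg.
have fgs : {in s, forall e, ignores e f \/ ignores e g}.
  by move=> x xs; apply: fg; rewrite inE xs orbT.
have fgs' : {in s, forall x, ignores x (fun A => f (e |: A)%SET) \/
                             ignores x (fun A => g (e |: A)%SET)}.
  by move=> x /fgs[] /ignores_setU1; [left|right].
rewrite !IHs//; case: (fg e (mem_head _ _)) => he; rewrite (eq_mean p s he);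
  ring.
Qed.

Lemma mean_mem p s e : uniq s -> e \in s -> mean p s (fun A => (e \in A)%:R) = p e.
Proof.
elim: s => //= x s IHs /andP[xs us]; rewrite inE => /predU1P[->|es].
  rewrite (@eq_mean _ _ _ (fun=> 1)); last by move=> A; rewrite !inE eqxx.
  rewrite mean_cst; suff -> : mean p s (fun A => (x \in A)%:R) = 0 by ring.
  elim: s xs {us IHs} => [|y s IHs]; first by rewrite /= finset.in_set0.
  rewrite inE => /norP[xy xs] /=; rewrite (IHs xs).
  rewrite (@eq_mean _ _ _ (fun A => (x \in A)%:R)); last first.
    by move=> A; rewrite !inE (negbTE xy).
  by rewrite (IHs xs); ring.
have ex : e != x by apply: contraNneq xs => <-.
rewrite (@eq_mean _ _ _ (fun A => (e \in A)%:R)); last first.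
  by move=> A; rewrite !inE (negbTE ex).
by rewrite IHs//; ring.
Qed.

Lemma ignores_mem e e' : e' != e -> ignores e' (fun A => (e \in A)%:R : R).
Proof. by move=> ee' A; rewrite !inE eq_sym (negbTE ee'). Qed.

(** Conditioning on the presence of [e]: on that event [f A] equals [f (e |: A)], which no longer
    depends on [e] and is therefore independent of the indicator. *)
Lemma mean_mem_mul p s e f : uniq s -> e \in s ->
  mean p s (fun A => (e \in A)%:R * f A) = p e * mean p s (fun A => f (e |: A)%SET).
Proof.
move=> us es.
rewrite (@eq_mean _ _ _ (fun A => (e \in A)%:R * f (e |: A)%SET)); last first.
  move=> A; have [eA|] := boolP (e \in A); last by rewrite !mul0r.
  by congr (_ * f _); apply/esym/finset.setUidPr; rewrite finset.sub1set.
rewrite mean_indep ?mean_mem// => x xs.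
have [->|xe] := eqVneq x e; first by right; exact: ignores_add.
by left; exact: ignores_mem.
Qed.

Section Probability.
Variable p : E -> R.
Hypothesis p01 : forall e, 0 <= p e <= 1.

Let p0 e : 0 <= p e. Proof. by case/andP: (p01 e). Qed.
Let p1 e : 0 <= 1 - p e. Proof. by rewrite subr_ge0; case/andP: (p01 e). Qed.

Lemma le_mean s f g : (forall A, f A <= g A) -> mean p s f <= mean p s g.
Proof.
elim: s f g => //= e s IHs f g fg.
by apply: lerD; apply: ler_wpM2l => //; apply: IHs => A.
Qed.

Lemma mean_ge0 s f : (forall A, 0 <= f A) -> 0 <= mean p s f.
Proof. by move=> f0; rewrite -(mean_cst p s 0); exact: le_mean. Qed.

Lemma normr_mean_le s f g : (forall A, `|f A| <= g A) ->
  `|mean p s f| <= mean p s g.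
Proof.
move=> fg; rewrite ler_norml -[- mean p s g]mulN1r -meanZ.
by rewrite !le_mean// => A; have := fg A; rewrite ler_norml ?mulN1r => /andP[].
Qed.

(** The probabilities are exchanged one element at a time; exchanging [p e] for [q e] costs their
    difference times a discrete derivative of the mean, which is at most [c]. *)
Lemma mean_interpolation s f q (c : R) (hq : forall e, 0 <= q e <= 1) :
    0 <= c -> {in s, forall e A, `|f (e |: A)%SET - f A| <= c} ->
  `|mean p s f - mean q s f| <= c * \sum_(e <- s) `|p e - q e|.
Proof.
move=> c0; elim: s f => [|e s IHs] f fc; first by rewrite big_nil /=
  subrr normr0 mulr0.
have fcs : {in s, forall e A, `|f (e |: A)%SET - f A| <= c}.
  by move=> x xs; apply: fc; rewrite inE xs orbT.
rewrite big_cons /=.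
set f1 := fun A => f (e |: A)%SET.
have fcs1 : {in s, forall x A, `|f1 (x |: A)%SET - f1 A| <= c}.
  by move=> x xs A; rewrite /f1 finset.setUCA; apply: fcs.
have h0 := IHs f fcs; have h1 := IHs f1 fcs1.
have hd : `|mean p s f1 - mean p s f| <= c.
  rewrite -meanB -(mean_cst p s c); apply: normr_mean_le => A.
  by apply: fc; rewrite mem_head.
set a1 := mean p s f1 in hd h1 *; set a0 := mean p s f in hd h0 *.
set b1 := mean q s f1 in h1 *; set b0 := mean q s f in h0 *.
have -> : p e * a1 + (1 - p e) * a0 - (q e * b1 + (1 - q e) * b0) =
  (p e - q e) * (a1 - a0) + (q e * (a1 - b1) + (1 - q e) * (a0 - b0)) by ring.
rewrite [leRHS]mulrDr; apply: le_trans (ler_normD _ _) _; apply: lerD.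
  by rewrite normrM mulrC ler_wpM2r.
case/andP: (hq e) => q0 q1.
apply: le_trans (ler_normD _ _) _; rewrite !normrM (ger0_norm q0).
rewrite (ger0_norm (_ : 0 <= 1 - q e)) ?subr_ge0//.
have -> : c * \sum_(x <- s) `|p x - q x| = q e * (c * \sum_(x <- s) `|p x - q x|)
  + (1 - q e) * (c * \sum_(x <- s) `|p x - q x|) by ring.
by apply: lerD; apply: ler_wpM2l; rewrite ?subr_ge0.
Qed.

(* Efron-Stein for functions with bounded differences *)
Lemma mean_variance s f (c : R) :
    {in s, forall e A, `|f (e |: A)%SET - f A| <= c} ->
  mean p s (fun A => (f A - mean p s f) ^+ 2) <= c ^+ 2 * \sum_(e <- s) p e.
Proof.
have varE t g : mean p t (fun A => (g A - mean p t g) ^+ 2) =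
    mean p t (fun A => g A ^+ 2) - mean p t g ^+ 2.
  rewrite (@eq_mean _ _ _ (fun A => g A ^+ 2 - 2 * mean p t g * g A
     + mean p t g ^+ 2)); last by move=> A; ring.
  by rewrite meanD meanB meanZ mean_cst; ring.
elim: s f => [|e s IHs] f fc.
  by rewrite big_nil mulr0 /= subrr expr0n.
have fcs : {in s, forall e A, `|f (e |: A)%SET - f A| <= c}.
  by move=> x xs; apply: fc; rewrite inE xs orbT.
pose f1 := fun A => f (e |: A)%SET.
have fcs1 : {in s, forall x A, `|f1 (x |: A)%SET - f1 A| <= c}.
  by move=> x xs A; rewrite /f1 finset.setUCA; apply: fcs.
have hd : `|mean p s f1 - mean p s f| <= c.
  rewrite -meanB -(mean_cst p s c); apply: normr_mean_le => A.
  by apply: fc; rewrite mem_head.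
have := IHs _ fcs; have := IHs _ fcs1; rewrite !varE big_cons /= -/f1.
rewrite -[mean p s (fun A => f (e |: A)%SET ^+ 2)]/(mean p s (fun A => f1 A ^+ 2)).
set a1 := mean p s f1 in hd *; set a0 := mean p s f in hd *.
set v1 := mean p s (fun A => f1 A ^+ 2); set v0 := mean p s (fun A => f A ^+ 2).
set S := c ^+ 2 * _ => h1 h0.
(* Law of total variance with respect to the presence of [e]: mean conditional variance, plus p (1 -
   p) times the squared gap of the conditional means. *)
have -> : p e * v1 + (1 - p e) * v0 - (p e * a1 + (1 - p e) * a0) ^+ 2 =
  p e * (v1 - a1 ^+ 2) + (1 - p e) * (v0 - a0 ^+ 2) +
  p e * ((1 - p e) * (a1 - a0) ^+ 2) by ring.
have -> : c ^+ 2 * (p e + \sum_(j <- s) p j) =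
  p e * S + (1 - p e) * S + p e * c ^+ 2 by rewrite /S; ring.
rewrite !lerD ?ler_wpM2l//.
have hd2 : (a1 - a0) ^+ 2 <= c ^+ 2.
  by rewrite -real_normK ?num_real// lerXn2r// nnegrE (le_trans _ hd).
apply: le_trans hd2; rewrite ler_piMl ?sqr_ge0//.
by rewrite lerBlDr lerDl.
Qed.

End Probability.
End RandomSubset.

(** * Poisson approximation *)

Section PoissonApproximation.
Variable R : realType.
Implicit Types (x : R) (k : nat).

(* The library's [poisson_pmf] takes the junk value 1 at rate 0. *)
Definition poi k x : R := x ^+ k / k`!%:R * expR (- x).

Lemma poi0 x : poi 0 x = expR (- x).
Proof. by rewrite /poi expr0 fact0 divr1 mul1r. Qed.

(** The recursion that drives the Poisson approximation: [count_probS] shows that a sum of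
    independent indicators satisfies it up to a small error. *)
Lemma poiS k x : k.+1%:R * poi k.+1 x = x * poi k x.
Proof.
rewrite /poi factS natrM exprS; field.
by rewrite nat1r !pnatr_eq0 -lt0n fact_gt0.
Qed.

Lemma poi_ge0 k x : 0 <= x -> 0 <= poi k x.
Proof. by move=> x0; rewrite !mulr_ge0 ?expR_ge0 ?exprn_ge0 ?invr_ge0. Qed.

Lemma poi_le1 k x : 0 <= x -> poi k x <= 1.
Proof.
move=> x0; rewrite /poi expRN ler_pdivrMr ?expR_gt0// mul1r.
case: k => [|k]; first by rewrite expr0 fact0 divr1 -[leLHS]addr0 (le_trans _
  (expR_ge1Dx x))// lerD2l.
by apply: le_trans (expR_ge1Dxn k x0); rewrite lerDr.
Qed.

Lemma expRN_approx x : 0 <= x <= 1 -> `|1 - x - expR (- x)| <= x ^+ 2.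
Proof.
move=> /andP[x0 x1]; rewrite ler_distlC.
have h1 := expR_ge1Dx (- x).
have := sqr_ge0 x => x2; apply/andP; split; first lra.
rewrite expRN; have h2 := expR_ge1Dx x.
suff : (expR x)^-1 <= 1 - x + x ^+ 2 by lra.
rewrite -[leLHS]mul1r ler_pdivrMr ?expR_gt0//.
(* [expR x] is at least 1 + x, and (1 - x + x^2)(1 + x) = 1 + x^3 is at least 1. *)
nra.
Qed.

Lemma expRN_lipschitz x y : 0 <= x -> 0 <= y ->
  `|expR (- x) - expR (- y)| <= `|x - y|.
Proof.
wlog xy : x y / x <= y => [hw x0 y0|x0 y0].
  by case: (leP x y) => [|/ltW] xy; [|rewrite distrC [leRHS]distrC]; exact: hw.
rewrite ger0_norm; last by rewrite subr_ge0 ler_expR lerN2.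
rewrite distrC (ger0_norm (_ : 0 <= y - x)) ?subr_ge0//.
have -> : expR (- y) = expR (- x) * expR (- (y - x)).
  by rewrite -expRD; congr expR; ring.
have h := expR_ge1Dx (- (y - x)).
have h0 : expR (- x) <= 1 by rewrite -expR0 ler_expR oppr_le0.
have h1 := expR_gt0 (- x).
have h2 : 0 <= y - x by rewrite subr_ge0.
set u := expR (- (y - x)) in h *; set w := expR (- x) in h0 h1 *.
have : w * (1 - u) <= w * (y - x) by rewrite ler_pM2l//; lra.
have : w * (y - x) <= 1 * (y - x) by rewrite ler_wpM2r.
nra.
Qed.

(** * Poisson approximation for the size of a random subset *)

Section Count.
Variables (E : finType) (p : E -> R) (s : seq E) (S : {set E}).
Hypothesis p01 : forall e, 0 <= p e <= 1.
Hypothesis us : uniq s.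
Hypothesis sS : {subset S <= s}.

Definition count_prob k : R := mean p s (fun A => (#|S :&: A| == k)%:R).

Lemma count_prob_ge0 k : 0 <= count_prob k.
Proof. exact: (mean_ge0 p01). Qed.

Lemma count_prob_le1 k : count_prob k <= 1.
Proof.
rewrite /count_prob -[leRHS](mean_cst p s); apply: le_mean => // A; by case: eqP.
Qed.

Let sigma : R := \sum_(e in S) p e ^+ 2.
Let lam : R := \sum_(e in S) p e.

(** On the event that the count is k + 1, the factor k + 1 is the number of elements of [S] present,
    so the left term is a sum over [e] in [S] of probabilities conditioned on [e] being present.
    Inserting [e] raises the count by one unless [e] was already there, which has probability [p e];
    the total error is the sum of the [p e ^+ 2]. *)
Lemma count_probS k : `|k.+1%:R * count_prob k.+1 - lam * count_prob k| <= sigma.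
Proof.
have -> : k.+1%:R * count_prob k.+1 =
    \sum_(e in S) p e * mean p s (fun A => (#|S :&: (e |: A)| == k.+1)%:R).
  rewrite /count_prob -meanZ.
  rewrite (@eq_mean _ _ _ _ _
    (fun A => \sum_(e in S) (e \in A)%:R * (#|S :&: A| == k.+1)%:R)).
    rewrite mean_sum; apply: eq_bigr => e eS.
    by rewrite mean_mem_mul// sS.
  move=> A; rewrite -mulr_suml; have [/eqP <-|] := boolP (#|S :&: A| == k.+1);
    last by rewrite !mulr0.
  congr (_ * _); rewrite -sum1_card natr_sum big_mkcond [RHS]big_mkcond/=.
  by apply: eq_bigr => e _; rewrite !inE; case: (e \in S); case: (e \in A).
rewrite /lam mulr_suml -sumrB; apply: le_trans (ler_norm_sum _ _ _) _.
apply: ler_sum => e eS; rewrite -mulrBr normrM.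
have /andP[pe0 pe1] := p01 e.
rewrite (ger0_norm pe0) expr2 ler_wpM2l// /count_prob -meanB.
rewrite -[leRHS](mean_mem p us (sS eS)); apply: normr_mean_le => // A.
have [eA|eA] := boolP (e \in A).
  by case: eqP; case: eqP; rewrite /= ?subrr ?normr0 ?subr0 ?sub0r ?normrN ?normr1.
rewrite finset.setIUr (finset.setIidPr _) ?finset.sub1set//.
rewrite finset.cardsU1 !inE (negbTE eA) andbF add1n eqSS.
by rewrite subrr normr0.
Qed.

Let sum_in_subseq (F : E -> R) :
  \sum_(e in S) F e = \sum_(e <- s | e \in S) F e.
Proof.
rewrite -big_enum -[RHS]big_filter /=; apply: perm_big; apply: uniq_perm.
- exact: enum_uniq.
- exact: filter_uniq.
- by move=> e; rewrite mem_enum mem_filter; case: (boolP (e \in S)) => // /sS ->.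
Qed.

(** The probability of an empty intersection is the product of the 1 - p e. Its factors are replaced
    by exponentials one by one, all factors staying in [0, 1], so the errors of [expRN_approx] add
    up. *)
Lemma count_prob0 : `|count_prob 0 - expR (- lam)| <= sigma.
Proof.
have -> : count_prob 0 = \prod_(e <- s | e \in S) (1 - p e).
  rewrite /count_prob.
  elim: s => [|e t IHt].
    by rewrite big_nil /= finset.setI0 cards0 eqxx.
  rewrite big_cons /=.
  have [eS|eS] := boolP (e \in S).
    rewrite IHt (@eq_mean _ _ _ _ _ (fun=> 0)) ?mean_cst; first by ring.
    move=> A; rewrite (_ : _ == _ = false)//; apply/negbTE; rewrite -lt0n.
    by apply/card_gt0P; exists e; rewrite !inE eqxx eS.
  rewrite (@eq_mean _ _ _ _ _ (fun A => (#|S :&: A| == 0)%:R)) ?IHt; first by ring.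
  move=> A; congr ((#|pred_of_set _| == _)%:R); apply/setP => x; rewrite !inE.
  by have [->|] := eqVneq x e; rewrite // (negbTE eS).
rewrite /lam /sigma !sum_in_subseq.
elim: s => [|e t IHt]; first by rewrite !big_nil oppr0 expR0 subrr normr0.
rewrite !big_cons; case: ifPn => // eS.
have /andP[pe0 pe1] := p01 e.
set a := \prod_(j <- t | _) _ in IHt *; set b := \sum_(j <- t | _) p _ in IHt *.
set c := \sum_(j <- t | _) _ in IHt *.
rewrite opprD expRD.
have -> : (1 - p e) * a - expR (- p e) * expR (- b) =
  (1 - p e - expR (- p e)) * expR (- b) + (1 - p e) * (a - expR (- b)) by ring.
apply: le_trans (ler_normD _ _) _; rewrite !normrM; apply: lerD.
  rewrite -[leRHS]mulr1 ler_pM// ?expRN_approx ?p01//.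
  rewrite ger0_norm ?expR_ge0// -expR0 ler_expR oppr_le0.
  by rewrite sumr_ge0// => x _; case/andP: (p01 x).
rewrite -[leRHS]mul1r ler_pM// ger0_norm ?subr_ge0//.
by rewrite lerBlDr lerDl.
Qed.

(** Induction on [k], comparing [count_probS] with the exact recursion [poiS]. Replacing [lam] by
    [theta] costs [delta], and each step multiplies the error by at most 1 + L because
    [theta <= L]. *)
Lemma count_prob_poisson (theta delta L : R) k :
    0 <= theta <= L -> `|lam - theta| <= delta ->
  `|count_prob k - poi k theta| <= (sigma + delta) * (1 + L) ^+ k.
Proof.
move=> /andP[t0 tL] ltd.
have L0 : 0 <= L by exact: le_trans tL.
have sig0 : 0 <= sigma by rewrite sumr_ge0// => e _; exact: sqr_ge0.
have d0 : 0 <= delta by exact: le_trans ltd.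
have lam0 : 0 <= lam by rewrite sumr_ge0// => x _; case/andP: (p01 x).
elim: k => [|k IHk].
  rewrite expr0 mulr1 poi0 (le_trans (ler_distD (expR (- lam)) _ _))// lerD//.
    exact: count_prob0.
  exact: le_trans (expRN_lipschitz _ _) _.
set P' := count_prob k in IHk; set P := count_prob k.+1.
set e := (sigma + delta) * (1 + L) ^+ k in IHk.
have P'0 : 0 <= P' <= 1 by rewrite count_prob_ge0 count_prob_le1.
have hk : `|k.+1%:R * (P - poi k.+1 theta)| <= sigma + delta + L * e.
  rewrite mulrBr poiS.
  have -> : k.+1%:R * P - theta * poi k theta = (k.+1%:R * P - lam * P') +
    ((lam - theta) * P' + theta * (P' - poi k theta)) by ring.
  apply: le_trans (ler_normD _ _) _; rewrite -addrA; apply: lerD;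
    first exact: count_probS.
  apply: le_trans (ler_normD _ _) _; rewrite !normrM; apply: lerD.
    by rewrite -[leRHS]mulr1 ler_pM// ger0_norm; case/andP: P'0.
  by rewrite ler_pM// ger0_norm.
have e1 : sigma + delta <= e.
  by rewrite /e -[leLHS]mulr1 ler_wpM2l ?addr_ge0// exprn_ege1// lerDl.
apply: (@le_trans _ _ (sigma + delta + L * e)); last first.
  by rewrite exprSr mulrA -/e mulrDr mulr1 lerD// mulrC.
(* The gain from dividing by k + 1 >= 1 is discarded. *)
apply: le_trans hk; rewrite normrM ger0_norm// ler_peMl//.
by rewrite ler1n.
Qed.

End Count.
End PoissonApproximation.

(** * Graphs as random edge sets *)

Lemma eq_mean_in (R : realFieldType) (E : finType) (p : E -> R) (s : seq E)
    (f g : {set E} -> R) :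
    (forall A : {set E}, {subset A <= s} -> f A = g A) ->
  mean p s f = mean p s g.
Proof.
elim: s f g => [|e s IHs] f g fg /=.
  by apply: fg => x; rewrite finset.in_set0.
rewrite (IHs f g); last first.
  by move=> A As; apply: fg => x /As xs; rewrite inE xs orbT.
rewrite (IHs (fun A => f (e |: A)%SET) (fun A => g (e |: A)%SET))// => A As.
by apply: fg => x; rewrite !inE => /orP[->//|/As ->]; rewrite orbT.
Qed.

(** Identifies the recursive [mean] with the product law: this is the form taken by
    [independent_edges_pmf]. *)
Lemma mean_eq_set (R : realFieldType) (E : finType) (p : E -> R) (s : seq E)
    (B : {set E}) :
    uniq s -> {subset B <= s} ->
  mean p s (fun A => (A == B)%:R) = \prod_(e <- s) (if e \in B then p e else 1 -
    p e).
Proof.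
elim: s B => [|e s IHs] B /=.
  move=> _ Bs; rewrite big_nil; case: eqP => // -[].
  by apply/setP => x; rewrite !inE; apply/esym/negbTE/negP => /Bs.
move=> /andP[es us] Bs; rewrite big_cons.
pose B' := (B :\ e)%SET.
have B's : {subset B' <= s}.
  by move=> x; rewrite !inE => /andP[xe /Bs]; rewrite inE (negbTE xe).
have -> : \prod_(j <- s) (if j \in B then p j else 1 - p j) =
    \prod_(j <- s) (if j \in B' then p j else 1 - p j).
  rewrite !big_seq; apply: eq_bigr => x xs; rewrite !inE.
  by have -> : x != e by apply: contraNneq es => <-.
case: ifPn => eB.
  rewrite [X in _ + _ * X](@eq_mean_in _ _ _ _ _ (fun=> 0)); last first.
    by move=> A As; case: eqP => // AB; case/negP: es; apply: As; rewrite AB.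
  rewrite mean_cst mulr0 addr0 -IHs//; congr (_ * _); apply: eq_mean_in => A As.
  rewrite /B'; congr (_%:R); congr nat_of_bool; apply/eqP/eqP => [AB|->].
    apply/setP => x; rewrite -AB !inE; have [->|//] := eqVneq x e.
    by apply/negbTE; apply: contra es; exact: As.
  by rewrite finset.setD1K.
rewrite [X in _ * X + _](@eq_mean_in _ _ _ _ _ (fun=> 0)); last first.
  by move=> A As; case: eqP => // AB; move: eB; rewrite -AB !inE eqxx.
rewrite mean_cst mulr0 add0r IHs//.
  congr (_ * _); rewrite !big_seq; apply: eq_bigr => x xs; rewrite !inE.
  by have -> : x != e by apply: contraNneq es => <-.
move=> x xB; have := Bs _ xB; rewrite inE => /predU1P[xe|//].
by move: eB; rewrite -xe xB.
Qed.

Section GraphOfEdges.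
Variable n : nat.
Implicit Types (k l : nat) (u v : 'I_n) (A : {set 'I_n * 'I_n}) (g : sgraph 'I_n).

(** Unordered pairs are represented by increasing ones. On the diagonal the value is a pair outside
    [edges], hence the conditions u != v below. *)
Definition edge u v : 'I_n * 'I_n := if (u < v)%N then (u, v) else (v, u).

Lemma edgeC u v : edge u v = edge v u.
Proof.
rewrite /edge; case: ltngtP => // uv.
by have -> : u = v by exact: val_inj.
Qed.

Lemma edge_inj u v w : v != u -> w != u -> edge u v = edge u w -> v = w.
Proof.
move=> vu wu; rewrite /edge; case: ifP => uv; case: ifP => uw [] //.
by move=> uw'; rewrite uw' eqxx in wu.
by move=> vu'; rewrite vu' eqxx in vu.
Qed.

Definition edges : seq ('I_n * 'I_n) :=
  enum [pred e : 'I_n * 'I_n | (e.1 < e.2)%N].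

Lemma mem_edges (e : 'I_n * 'I_n) : (e \in edges) = (e.1 < e.2)%N.
Proof. by rewrite mem_enum inE. Qed.

Lemma uniq_edges : uniq edges. Proof. exact: enum_uniq. Qed.

Lemma edge_edges u v : u != v -> edge u v \in edges.
Proof.
move=> uv; rewrite mem_edges /edge; case: (ltngtP u v) => [//|//|uv'];
  last by move: uv; rewrite (ord_inj uv') eqxx.
Qed.

Definition edge_arcs A : {set 'I_n * 'I_n} :=
  [set e | (e.1 != e.2) && (edge e.1 e.2 \in A)].

Lemma edge_arcs_simple A : simple_arcs (edge_arcs A).
Proof.
apply/andP; split; first by apply/forallP => u; rewrite inE eqxx.
by apply/forallP => u; apply/forallP => v; rewrite !inE /= eq_sym edgeC implybb.
Qed.

Definition graph_of A : sgraph 'I_n := SGraph (edge_arcs_simple A).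

Lemma arcs_graph_of A u v :
  ((u, v) \in arcs (graph_of A)) = (u != v) && (edge u v \in A).
Proof. by rewrite inE. Qed.

Lemma arcsC g u v : ((u, v) \in arcs g) = ((v, u) \in arcs g).
Proof.
have /andP[_ /forallP h] := arcsP g.
by apply/idP/idP; [have /forallP/(_ v)/implyP := h u|
  have /forallP/(_ u)/implyP := h v]; exact.
Qed.

Lemma arcs_irrefl g u : (u, u) \notin arcs g.
Proof. by have /andP[/forallP/(_ u)] := arcsP g. Qed.

(** The inclusion is what makes the preimage of [g] a single set: [graph_of] ignores the elements of
    [A] that are not increasing pairs. *)
Lemma graph_of_eq g A : {subset A <= edges} ->
  (graph_of A == g) = (A == [set e : 'I_n * 'I_n | (e.1 < e.2)%N && (e \in arcs
    g)])%SET.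
Proof.
move=> As; apply/eqP/eqP => [<-|AE].
  apply/setP => -[u v]; rewrite !inE /= -[(u < v)%N]/((u, v).1 < (u,
    v).2)%N -mem_edges.
  have [uvA|uvA] := boolP ((u, v) \in A).
    have uv := As _ uvA; rewrite uv /=; move: uv; rewrite mem_edges /= => uv.
    by rewrite /edge uv uvA andbT neq_ltn uv.
  rewrite mem_edges/=; have [uv|//] := boolP (u < v)%N.
  by rewrite /edge uv (negbTE uvA) andbF.
apply: val_inj; apply/setP => -[u v]; rewrite inE/= AE !inE.
rewrite /edge; case: ifP => /= [uv|/negbT]; first by rewrite uv neq_ltn uv.
rewrite -leqNgt leq_eqVlt => /predU1P[vu|vu].
  have -> : u = v by exact: val_inj.
  by rewrite eqxx (negbTE (arcs_irrefl _ _)).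
by rewrite vu neq_ltn vu orbT arcsC.
Qed.

Lemma mean_graph_of (R : realType) (p : 'I_n -> 'I_n -> R) (f : sgraph 'I_n -> R) :
  \sum_g independent_edges_pmf p g * f g =
  mean (fun e => p e.1 e.2) edges (fun A => f (graph_of A)).
Proof.
transitivity (mean (fun e => p e.1 e.2) edges
    (fun A => \sum_g f g * (graph_of A == g)%:R)); last first.
  apply: eq_mean => A; rewrite (bigD1 (graph_of A))//= eqxx mulr1 big1 ?addr0//.
  by move=> g; rewrite eq_sym => /negbTE ->; rewrite mulr0.
rewrite mean_sum; apply: eq_bigr => g _; rewrite meanZ mulrC; congr (_ * _).
rewrite (@eq_mean_in _ _ _ _ _ (fun A =>
  (A == [set e : 'I_n * 'I_n | (e.1 < e.2)%N && (e \in arcs g)]%SET)%:R));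
    last first.
  by move=> A As; rewrite graph_of_eq.
rewrite mean_eq_set ?uniq_edges//; last first.
  by move=> e; rewrite inE mem_edges => /andP[].
rewrite /edges big_enum_cond /=; apply: eq_big => [e|e]; rewrite ?andbT ?inE//.
by move=> /= ->; case: e.
Qed.

Definition star u : {set 'I_n * 'I_n} := [set edge u v | v in predC1 u]%SET.

Lemma star_edges u : {subset star u <= edges}.
Proof. by move=> _ /imsetP[v vu ->]; apply: edge_edges; rewrite eq_sym. Qed.

Lemma mem_star u v : u != v -> edge u v \in star u.
Proof. by move=> uv; apply/imsetP; exists v => //; rewrite !inE eq_sym. Qed.

Lemma degree_graph_of A u : degree (graph_of A) u = #|star u :&: A|%SET.
Proof.
rewrite /degree -(@card_in_imset _ _ (edge u)); last first.
  move=> v w; rewrite !inE/= => /andP[uv _] /andP[uw _].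
  by apply: edge_inj; rewrite eq_sym.
apply: eq_card => e; rewrite inE; apply/imsetP/andP => [[v]|[/imsetP[v]]].
  by rewrite inE arcs_graph_of => /andP[uv eA] ->; rewrite mem_star.
by rewrite inE => vu -> eA; exists v => //; rewrite inE arcs_graph_of eq_sym vu.
Qed.

(** Source of independence in the pair counts: once the edge between [u] and [v] is set aside, their
    remaining degrees depend on disjoint sets of potential edges. *)
Lemma starI u v e : u != v -> e \in star u -> e \in star v -> e = edge u v.
Proof.
move=> uv /imsetP[w] /[!inE] wu -> /imsetP[z] /[!inE] zv.
rewrite /edge; do 3! case: ifP => //; move=> h1 h2 h3 [] *; subst => //.
all: try by [rewrite eqxx in uv | rewrite eqxx in wu | rewrite eqxx in zv | lia].
Qed.

Definition degree_pairs k l g : nat :=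
  \sum_(e in arcs g) ((degree g e.1 == k) && (degree g e.2 == l)).

Lemma degree_pairsE k l g : degree_pairs k l g =
  (\sum_u \sum_v ((u, v) \in arcs g) && (degree g u == k) && (degree g v == l))%N.
Proof.
rewrite /degree_pairs pair_big big_mkcond /=; apply: eq_bigr => -[u v] _ /=.
by case: ifP.
Qed.

Let row_bound k l g u :
  (\sum_v ((u, v) \in arcs g) && (degree g u == k) && (degree g v == l) <= k)%N.
Proof.
have [<-|_] := eqVneq (degree g u) k; last by rewrite big1// => v _; rewrite andbF.
rewrite /degree -sum1_card [leqRHS]big_mkcond /=.
by apply: leq_sum => v _; rewrite inE andbT; case: (_ \in _) => //; case: (_ == _).
Qed.

Let col_bound k l g v :
  (\sum_u ((u, v) \in arcs g) && (degree g u == k) && (degree g v == l) <= l)%N.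
Proof.
apply: leq_trans (row_bound l k g v); apply: leq_sum => u _.
by rewrite arcsC -!andbA [X in _ && X]andbC.
Qed.

(* Only arcs touching x or y are affected, and at most 2(k + l) of those can be
   counted, because their degree at x or y is prescribed. *)
Lemma degree_pairs_diff k l g g' x y :
    (forall u v, u != x -> u != y -> ((u, v) \in arcs g) = ((u, v) \in arcs g')) ->
  (degree_pairs k l g <= degree_pairs k l g' + (k + l).*2)%N.
Proof.
move=> gg'; rewrite !degree_pairsE.
set F := fun h u v =>
  ((u, v) \in arcs h) && (degree h u == k) && (degree h v == l).
have dgg' u : u != x -> u != y -> degree g u = degree g' u.
  by move=> ux uy; apply: eq_card => v; rewrite !inE gg'.
(* If neither index is x or y, the arc and both degrees are the same in the two graphs. Otherwise
   the whole term is charged to a row or column of x or y, whose sum is at most k or l. *)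
have FE u v : (F g u v <= F g' u v + ((u == x) * F g u v + (u == y) * F g u v
    + ((v == x) * F g u v + (v == y) * F g u v)))%N.
  have [->|ux] := eqVneq u x; first by move: (F g x v) (F g' x v) (x == y) (v ==
    x) (v == y) => [] [] [] [] [].
  have [->|uy] := eqVneq u y; first by move: (F g y v) (F g' y v) (v == x) (v ==
    y) => [] [] [] [].
  have [->|vx] := eqVneq v x; first by move: (F g u x) (F g' u x) (x == y) =>
    [] [] [].
  have [->|vy] := eqVneq v y; first by move: (F g u y) (F g' u y) => [] [].
  by rewrite /F gg'// !dgg'// leq_addr.
apply: (@leq_trans (\sum_u \sum_v (F g' u v + ((u == x) * F g u v + (u == y)
  * F g u v
    + ((v == x) * F g u v + (v == y) * F g u v))))).
  by apply: leq_sum => u _; apply: leq_sum => v _; exact: FE.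
have rowE z : (\sum_u \sum_v (u == z) * F g u v <= k)%N.
  rewrite (bigD1 z)//= [X in (_ + X)%N]big1 ?addn0.
    by under eq_bigr do rewrite eqxx mul1n; exact: row_bound.
  by move=> u /negbTE uz; rewrite big1// => v _; rewrite uz.
have colE z : (\sum_u \sum_v (v == z) * F g u v <= l)%N.
  rewrite exchange_big (bigD1 z)//= [X in (_ + X)%N]big1 ?addn0.
    by under eq_bigr do rewrite eqxx mul1n; exact: col_bound.
  by move=> u /negbTE uz; rewrite big1// => v _; rewrite uz.
under eq_bigr do rewrite !big_split /=.
rewrite !big_split /=.
have := rowE x; have := rowE y; have := colE x; have := colE y => h1 h2 h3 h4.
apply: leq_add; first exact: leqnn.
by rewrite -addnn addnACA; apply: leq_add; apply: leq_add.
Qed.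

Lemma degree_pairs_add (R : realFieldType) k l e A :
  `|(degree_pairs k l (graph_of (e |: A)%SET))%:R -
    (degree_pairs k l (graph_of A))%:R| <= (k + l).*2%:R :> R.
Proof.
have h u v : u != e.1 -> u != e.2 -> ((u, v) \in arcs (graph_of (e |: A)%SET)) =
    ((u, v) \in arcs (graph_of A)).
  move=> u1 u2; rewrite !arcs_graph_of !inE.
  have [eE|//] := eqVneq (edge u v) e; move: u1 u2.
  by rewrite -eE /edge; case: ifP => /=; rewrite eqxx.
rewrite ler_distl lerBlDr -!natrD !ler_nat.
by rewrite !(@degree_pairs_diff _ _ _ _ e.1 e.2)// => *; rewrite h.
Qed.

(** Requiring the edge between [u] and [v] gives the factor [p] and uses up one unit of each degree,
    hence the shift from k + 1, l + 1 to k, l. By [starI] the remaining two counts are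
    independent. *)
Lemma mean_degree_pairs (R : realType) (p : 'I_n * 'I_n -> R) k l :
  mean p edges (fun A => (degree_pairs k.+1 l.+1 (graph_of A))%:R) =
  \sum_u \sum_(v | v != u) p (edge u v) *
    (count_prob p edges (star u :\ edge u v)%SET k *
     count_prob p edges (star v :\ edge u v)%SET l).
Proof.
transitivity (mean p edges (fun A => \sum_u \sum_(v | v != u)
    (edge u v \in A)%:R * ((degree (graph_of A) u == k.+1)%:R *
    (degree (graph_of A) v == l.+1)%:R))).
  apply: eq_mean => A; rewrite degree_pairsE natr_sum; apply: eq_bigr => u _.
  rewrite natr_sum [RHS]big_mkcond; apply: eq_bigr => v _ /=.
  rewrite arcs_graph_of eq_sym; case: (v != u) => //=.
  by rewrite -!natrM !mulnb andbA.
rewrite mean_sum; apply: eq_bigr => u _.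
rewrite mean_sum; apply: eq_bigr => v vu.
have uv : u != v by rewrite eq_sym.
rewrite mean_mem_mul ?uniq_edges ?edge_edges//; congr (_ * _).
have degE w z k' A : w != z -> (degree (graph_of (edge w z |: A)%SET) w == k'.+1) =
    (#|(star w :\ edge w z) :&: A|%SET == k').
  move=> wz; rewrite degree_graph_of (cardsD1 (edge w z)) !inE eqxx mem_star//=.
  rewrite add1n eqSS; congr (#|pred_of_set _| == _); apply/setP => x; rewrite !inE.
  by case: (x == edge w z).
rewrite (@eq_mean _ _ _ _ _ (fun A =>
  (#|(star u :\ edge u v) :&: A|%SET == k)%:R *
  (#|(star v :\ edge u v) :&: A|%SET == l)%:R)); last first.
  by move=> A; rewrite degE// [edge u v]edgeC degE.
have ign (S : {set 'I_n * 'I_n}) e k' : e \notin S ->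
    ignores e (fun A => (#|S :&: A|%SET == k')%:R : R).
  move=> eS A; congr ((#|pred_of_set _| == _)%:R); apply/setP => x; rewrite !inE.
  by have [->|] := eqVneq x e; rewrite // (negbTE eS).
rewrite mean_indep// => e _.
have [eu|/ign] := boolP (e \in star u :\ edge u v)%SET; last by left.
right; apply: ign; move: eu; rewrite !inE => /andP[ee eu].
rewrite ee /=; apply: contra ee => ev; apply/eqP; exact: starI.
Qed.

Lemma sum_star (R : nmodType) (F : 'I_n * 'I_n -> R) u v : u != v ->
  \sum_(e in (star u :\ edge u v)%SET) F e =
  \sum_(w | (w != u) && (w != v)) F (edge u w).
Proof.
move=> uv; rewrite -(@big_imset _ _ _ _ _ (edge u) [pred w | (w != u) && (w !=
  v)]) /=.
  apply: eq_bigl => e; rewrite !inE; apply/andP/imsetP => [[ee /imsetP[w]]|[w]].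
    rewrite inE => wu eE; exists w => //; rewrite inE wu /=.
    by apply: contra ee => /eqP <-; rewrite eE.
  rewrite inE => /andP[wu wv] ->; split; last by rewrite mem_star// eq_sym.
  by apply: contra wv => /eqP/edge_inj ->//; rewrite eq_sym.
by move=> w z /[!inE] /andP[wu _] /andP[zu _]; exact: edge_inj.
Qed.

End GraphOfEdges.

(** * Bounded weights *)

Lemma dist_mul_le (R : realFieldType) (L a b a' b' : R) :
    `|a| <= L -> `|b'| <= L ->
  `|a * b - a' * b'| <= L * (`|a - a'| + `|b - b'|).
Proof.
move=> aL bL.
have -> : a * b - a' * b' = (a - a') * b' + a * (b - b') by ring.
apply: le_trans (ler_normD _ _) _; rewrite !normrM mulrDr.
by rewrite lerD// ?ler_wpM2r// mulrC ler_wpM2r.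
Qed.

Section BoundedWeights.
Variables (R : realType) (m c K : R).
Hypotheses (m0 : 0 < m) (c0 : 0 <= c) (K0 : 0 <= K).

Definition weight_edge_prob (n : nat) (v : 'I_n -> R) (e : 'I_n * 'I_n) : R :=
  v e.1 * v e.2 / (n%:R * m).

(** The empirical counterpart of [truncated_size_biased]. The rate is [v u * c] because the mean
    degree of [u] is about v_u times the average of [v] divided by [m], and [c * m] is the value
    that average is to approach. *)
Definition weight_mean (n : nat) (v : 'I_n -> R) k : R :=
  n%:R^-1 * \sum_u v u * poi k (v u * c).

Section Fixed.
Variables (n : nat) (v : 'I_n.+1 -> R).
Hypothesis vK : forall u, 0 <= v u <= K.
Hypothesis Kn : K ^+ 2 <= n.+1%:R * m.

Let N : R := n.+1%:R.
Let N0 : 0 < N. Proof. by rewrite ltr0n. Qed.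
Let Ni : 0 <= N^-1. Proof. by rewrite invr_ge0. Qed.
Let p := weight_edge_prob v.

Let vv u w : 0 <= v u * v w / (N * m) <= K ^+ 2 / (N * m).
Proof.
have /andP[u0 uK] := vK u; have /andP[w0 wK] := vK w.
have Nm : 0 <= (N * m)^-1 by rewrite invr_ge0 mulr_ge0// ltW.
by rewrite !mulr_ge0//= expr2 ler_wpM2r// ler_pM.
Qed.

Lemma weight_edge_prob01 e : 0 <= p e <= 1.
Proof.
have /andP[h0 hK] := vv e.1 e.2; rewrite /p /weight_edge_prob h0 (le_trans hK)//.
by rewrite ler_pdivrMr ?mul1r// mulr_gt0.
Qed.

Let p_edge u w : p (edge u w) = v u * v w / (N * m).
Proof.
by rewrite /p /weight_edge_prob /edge; case: ifP => //= _; rewrite [v w * _]mulrC.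
Qed.

Let theta_itv u : 0 <= v u * c <= K * c.
Proof.
by have /andP[u0 uK] := vK u; rewrite mulr_ge0//= ler_wpM2r.
Qed.

Let D : R := `|N^-1 * \sum_w v w - c * m|.
(** The bound of [count_prob_poisson] with L = K c. The sum of squares is at most N (K^2/(N m))^2;
    two terms K^2/(N m) pay for the loop at [u] and the removed edge; K/m * D pays for replacing the
    empirical mean weight by [c * m]. *)
Let err (k : nat) : R :=
  (K ^+ 4 / (N * m ^+ 2) + (K ^+ 2 / (N * m) *+ 2 + K / m * D)) * (1 + K * c) ^+ k.

Let count_approx u w k : u != w ->
  `|count_prob p (edges n.+1) (star u :\ edge u w)%SET k - poi k (v u * c)| <=
    err k.
Proof.
move=> uw; have sub : {subset (star u :\ edge u w)%SET <= edges n.+1}.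
  by move=> e; rewrite inE => /andP[_]; exact: star_edges.
have /andP[u0 uK] := vK u.
apply: le_trans (count_prob_poisson weight_edge_prob01 (uniq_edges _) sub _
  (theta_itv u) (lexx _)) _.
rewrite ler_wpM2r ?exprn_ge0 ?addr_ge0 ?mulr_ge0//; apply: lerD.
  rewrite sum_star//; apply: le_trans (_ : \sum_(j < n.+1) (K ^+ 2 / (N * m))
    ^+ 2 <= _).
    rewrite big_mkcond; apply: ler_sum => j _; case: ifP => _; last exact: sqr_ge0.
    by rewrite p_edge; have /andP[h0 hK] := vv u j;
      rewrite lerXn2r// nnegrE (le_trans h0).
  rewrite sumr_const card_ord -[leLHS]mulr_natr -/N le_eqVlt; apply/orP; left.
  by apply/eqP; field; rewrite !gt_eqF.
rewrite sum_star//.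
(* The punctured star is the full sum over all vertices minus the terms for [u] and [w]. *)
have -> : \sum_(j | (j != u) && (j != w)) p (edge u j) - v u * c =
   v u / m * (N^-1 * \sum_w v w - c * m) - (v u * v u / (N * m)
     + v u * v w / (N * m)).
  have -> : v u / m * (N^-1 * \sum_w v w - c * m) =
      \sum_j v u * v j / (N * m) - v u * c.
    have -> : \sum_j v u * v j / (N * m) = v u / (N * m) * \sum_w v w.
      by rewrite mulr_sumr; apply: eq_bigr => j _; rewrite mulrAC.
    by field; rewrite !gt_eqF.
  rewrite [in RHS](bigD1 u)//= [in RHS](bigD1 w)/= 1?eq_sym//.
  rewrite (eq_bigr (fun j => v u * v j / (N * m))); last by move=> j _;
    rewrite p_edge.
  by ring.
rewrite [leRHS]addrC; apply: le_trans (ler_normB _ _) _; apply: lerD.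
  have mi : 0 <= m^-1 by rewrite invr_ge0 ltW.
  by rewrite normrM ger0_norm ?mulr_ge0// ler_wpM2r// ler_wpM2r.
have /andP[h0 hK] := vv u u; have /andP[h0' hK'] := vv u w.
by rewrite ger0_norm ?addr_ge0// mulr2n lerD.
Qed.

Let poi_bound u k : `|poi k (v u * c)| <= 1.
Proof.
by have /andP[t0 _] := theta_itv u; rewrite ger0_norm ?poi_ge0 ?poi_le1.
Qed.

Lemma mean_degree_pairs_weight k l :
  `|N^-1 * mean p (edges n.+1) (fun A => (degree_pairs k.+1 l.+1 (graph_of A))%:R) -
    weight_mean v k * weight_mean v l / m| <=
  K ^+ 2 / m * (err k + err l) + K ^+ 2 / (N * m).
Proof.
rewrite mean_degree_pairs.
set Q := fun u w => v u * v w / (N * m).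
set P := fun k u w => count_prob p (edges n.+1) (star u :\ edge u w)%SET k.
pose pi k u := poi k (v u * c).
(* The product of empirical means is a double sum that includes the diagonal, absent from the pair
   count. The diagonal part accounts for the error K^2/(N m). *)
have -> : weight_mean v k * weight_mean v l / m =
    N^-1 * \sum_u \sum_(w | w != u) Q u w * (pi k u * pi l w) +
    N^-1 * \sum_u Q u u * (pi k u * pi l u).
  rewrite -mulrDr -big_split /= /weight_mean.
  have -> : N^-1 * (\sum_u v u * poi k (v u * c)) *
      (N^-1 * (\sum_w v w * poi l (v w * c))) / m =
      N^-1 * ((N * m)^-1 * ((\sum_u v u * pi k u) * (\sum_w v w * pi l w))).
    by rewrite /pi; field; rewrite !gt_eqF.
  congr (_ * _); rewrite mulr_suml mulr_sumr; apply: eq_bigr => u _.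
  rewrite addrC -(bigD1 (P := xpredT) u (F := fun w =>
    Q u w * (pi k u * pi l w)))//=.
  rewrite !mulr_sumr; apply: eq_bigr => w _.
  by rewrite /Q; ring.
rewrite opprD addrA -mulrBr; apply: le_trans (ler_normB _ _) _; apply: lerD.
  rewrite -sumrB normrM (ger0_norm Ni).
  rewrite mulrC ler_pdivrMr//.
  apply: le_trans (ler_norm_sum _ _ _) _.
  apply: (@le_trans _ _ (\sum_(u < n.+1) (N * (K ^+ 2 / (N * m)
    * (err k + err l))))); last first.
    rewrite sumr_const card_ord -mulr_natr -/N le_eqVlt; apply/orP; left.
    by apply/eqP; field; rewrite !gt_eqF.
  apply: ler_sum => u _; rewrite -sumrB; apply: le_trans (ler_norm_sum _ _ _) _.
  apply: (@le_trans _ _ (\sum_(w < n.+1) (K ^+ 2 / (N * m) * (err k + err l))));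
    last first.
    by rewrite sumr_const card_ord -mulr_natl.
  rewrite big_mkcond; apply: ler_sum => w _.
  have err0 j : 0 <= err j.
    have m0' := ltW m0; have N0' := ltW N0; have D0 : 0 <= D by exact: normr_ge0.
    by rewrite /err !(addr_ge0, mulr_ge0, exprn_ge0, mulrn_wge0)//
      ?invr_ge0 ?mulr_ge0 ?exprn_ge0//.
  have Nm : 0 <= (N * m)^-1 by rewrite invr_ge0 mulr_ge0// ltW.
  case: ifP => [wu|_]; last by rewrite mulr_ge0 ?mulr_ge0 ?exprn_ge0 ?addr_ge0.
  have /andP[h0 hK] := vv u w.
  have uw : u != w by rewrite eq_sym.
  rewrite p_edge -mulrBr normrM ger0_norm// ler_pM//.
  apply: le_trans (dist_mul_le (L := 1) _ _ _ _) _.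
  - by rewrite ger0_norm ?count_prob_ge0 ?count_prob_le1//;
    exact: weight_edge_prob01.
  - exact: poi_bound.
  - rewrite mul1r lerD//; first exact: count_approx.
    by rewrite edgeC; apply: count_approx; rewrite eq_sym.
rewrite normrM (ger0_norm Ni) mulrC ler_pdivrMr//.
apply: le_trans (ler_norm_sum _ _ _) _.
rewrite [leRHS](_ : _ = \sum_(u < n.+1) K ^+ 2 / (N * m)); last first.
  by rewrite sumr_const card_ord -mulr_natr.
apply: ler_sum => u _; have /andP[h0 hK] := vv u u.
rewrite normrM -[leRHS]mulr1 ler_pM//; first by rewrite ger0_norm.
by rewrite normrM mulr_ile1//; exact: poi_bound.
Qed.

Lemma weight_mean_itv k : 0 <= weight_mean v k <= K.
Proof.
have b u : 0 <= v u * poi k (v u * c) <= K.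
  have /andP[u0 uK] := vK u; have /andP[t0 _] := theta_itv u.
  by rewrite mulr_ge0 ?poi_ge0//= -[leRHS]mulr1 ler_pM ?poi_ge0 ?poi_le1.
rewrite /weight_mean -/N mulr_ge0 ?sumr_ge0//=; last first.
  by move=> u _; case/andP: (b u).
rewrite mulrC ler_pdivrMr// [leRHS](_ : _ = \sum_(u < n.+1) K).
  by apply: ler_sum => u _; case/andP: (b u).
by rewrite sumr_const card_ord -mulr_natr.
Qed.

End Fixed.

(** Uniformity is the point: [B] is fixed before [n], the weights and the targets [a], [b], so the
    bound can be integrated over random weights before n -> oo. *)
Lemma mean_degree_pairs_approx k l : exists2 B : R, 0 <= B &
  forall n (v : 'I_n.+1 -> R) (a b : R),
    (forall u, 0 <= v u <= K) -> K ^+ 2 <= n.+1%:R * m ->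
    0 <= a <= K -> 0 <= b <= K ->
  `|n.+1%:R^-1 * mean (weight_edge_prob v) (edges n.+1)
      (fun A => (degree_pairs k.+1 l.+1 (graph_of A))%:R) - a * b / m| <=
  B * (n.+1%:R^-1 + `|n.+1%:R^-1 * \sum_w v w - c * m| +
       `|weight_mean v k - a| + `|weight_mean v l - b|).
Proof.
pose X := (1 + K * c) ^+ k + (1 + K * c) ^+ l.
pose B1 := K ^+ 2 / m * ((K ^+ 4 / m ^+ 2 + K ^+ 2 / m *+ 2) * X) + K ^+ 2 / m.
pose B2 := K ^+ 2 / m * (K / m * X).
have X0 : 0 <= X by rewrite addr_ge0// exprn_ge0 ?addr_ge0 ?mulr_ge0.
have m0' : 0 <= m^-1 by rewrite invr_ge0 ltW.
have m02 : 0 <= (m ^+ 2)^-1 by rewrite invr_ge0 exprn_ge0// ltW.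
have B10 : 0 <= B1 by rewrite !(addr_ge0, mulr_ge0, exprn_ge0, mulrn_wge0).
have B20 : 0 <= B2 by rewrite !(addr_ge0, mulr_ge0, exprn_ge0).
have B30 : 0 <= K / m by rewrite mulr_ge0.
exists (B1 + B2 + K / m); first by rewrite (addr_ge0 (addr_ge0 B10 B20) B30).
move=> n v a b vK Kn /andP[a0 aK] /andP[b0 bK].
have N0 : 0 < n.+1%:R :> R by rewrite ltr0n.
apply: le_trans (ler_distD (weight_mean v k * weight_mean v l / m) _ _) _.
have h1 := mean_degree_pairs_weight vK Kn k l.
have h2 : `|weight_mean v k * weight_mean v l / m - a * b / m| <=
    K / m * (`|weight_mean v k - a| + `|weight_mean v l - b|).
  rewrite -mulrBl normrM (ger0_norm m0') [leRHS]mulrAC ler_wpM2r//.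
  apply: dist_mul_le; last by rewrite ger0_norm.
  by have /andP[? ?] := weight_mean_itv vK k; rewrite ger0_norm.
apply: le_trans (lerD h1 h2) _.
set D := `|_ * _ - c * m|; set N := n.+1%:R.
set Fa := `|_ - a|; set Fb := `|_ - b|.
have -> : K ^+ 2 / m * ((K ^+ 4 / (N * m ^+ 2) + (K ^+ 2 / (N * m)
  *+ 2 + K / m * D)) *
  (1 + K * c) ^+ k +
  (K ^+ 4 / (N * m ^+ 2) + (K ^+ 2 / (N * m) *+ 2 + K / m * D)) * (1 + K * c)
    ^+ l) +
  K ^+ 2 / (N * m) = B1 * N^-1 + B2 * D.
  by rewrite /B1 /B2 /X; field; rewrite !gt_eqF.
have ND : 0 <= N^-1 by rewrite invr_ge0 ltW.
have D0 : 0 <= D by exact: normr_ge0.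
have Fa0 : 0 <= Fa by exact: normr_ge0.
have Fb0 : 0 <= Fb by exact: normr_ge0.
move: (K / m) B30 => C C0.
have -> : (B1 + B2 + C) * (N^-1 + D + Fa + Fb) = B1 * N^-1 + B2 * D + C * (Fa +
  Fb) +
  (B1 * (D + Fa + Fb) + B2 * (N^-1 + Fa + Fb) + C * (N^-1 + D)) by ring.
clearbody B1 B2 D Fa Fb; rewrite lerDl; repeat (apply: addr_ge0 || apply:
  mulr_ge0) => //.
Qed.

End BoundedWeights.

(** Turns second-moment bounds into L1 bounds without square roots, at the price of a free small
    [eta]. *)
Lemma normr_le_AMGM (R : realFieldType) (x eta : R) : 0 < eta ->
  `|x| <= eta + eta^-1 * x ^+ 2.
Proof.
move=> eta0; have [xe|ex] := leP `|x| eta.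
  by rewrite (le_trans xe)// lerDl mulr_ge0 ?sqr_ge0 ?invr_ge0 ?ltW.
apply: (@le_trans _ _ (eta^-1 * x ^+ 2)); last by rewrite lerDr ltW.
rewrite mulrC ler_pdivlMr// -real_normK ?num_real// expr2 ler_wpM2l//.
exact: ltW.
Qed.

Definition truncate (R : realFieldType) (K y : R) : R := if y <= K then y else 0.

Lemma truncate_itv (R : realFieldType) (K y : R) : 0 <= K -> 0 <= y ->
  0 <= truncate K y <= K.
Proof. by move=> K0 y0; rewrite /truncate; case: (leP y K) => [yK|_];
  rewrite ?y0 ?yK ?lexx ?K0. Qed.

Lemma truncate_le (R : realFieldType) (K y : R) : 0 <= y -> truncate K y <= y.
Proof. by move=> y0; rewrite /truncate; case: ifP. Qed.

(** If both weights are at most [K], the minimum with 1 is inactive and both sides vanish. Otherwise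
    a truncated weight is 0, and the right side is the full ratio w_i w_j/(n m), which dominates the
    minimum. *)
Lemma irg_edge_prob_weight (R : realType) (n : nat) (m K : R) (w : 'I_n.+1 -> R)
    (i j : 'I_n.+1) :
    0 < m -> 0 <= K -> (forall u, 0 <= w u) -> K ^+ 2 <= n.+1%:R * m ->
  `|irg_edge_prob m w i j - truncate K (w i) * truncate K (w j) / (n.+1%:R * m)|
  <= ((w i - truncate K (w i)) * w j + truncate K (w i) * (w j - truncate K (w j)))
     / (n.+1%:R * m).
Proof.
move=> m0 K0 w0 Kn; rewrite /irg_edge_prob.
have Nm : 0 < n.+1%:R * m by rewrite mulr_gt0.
have wij : 0 <= w i * w j / (n.+1%:R * m) by rewrite divr_ge0 ?mulr_ge0// ltW.
have easy : `|Num.min (w i * w j / (n.+1%:R * m)) 1| <= w i * w j / (n.+1%:R * m).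
  by rewrite ger0_norm ?ge_min ?lexx// le_min wij ler01.
rewrite /truncate; case: (leP (w i) K) => iK; case: (leP (w j) K) => jK;
  rewrite ?(mulr0, mul0r, subr0, subrr, addr0, add0r)//.
rewrite min_l ?subrr ?normr0// ler_pdivrMr// mul1r (le_trans _ Kn)//.
by rewrite expr2 ler_pM.
Qed.

(** * Deviation of the pair counts given the weights *)

Section IrgDeviation.
Variables (R : realType) (m c K : R).
Hypotheses (m0 : 0 < m) (c0 : 0 <= c) (K0 : 0 <= K).

Definition flip_bound (k l : nat) : R := (k.+1 + l.+1).*2%:R.

(** Collects three errors at fixed weights: variance under the true edge probabilities, cost of
    truncating them, and distance of the truncated mean from [a * b / m]; [q] is the untruncated
    target. The sums over [edges] involve only products of weights at distinct vertices. *)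
Lemma mean_degree_pairs_deviation k l : exists2 B : R, 0 <= B &
  forall n (w v : 'I_n.+1 -> R) (a b q eta : R), v = truncate K \o w ->
    (forall u, 0 <= w u) -> K ^+ 2 <= n.+1%:R * m ->
    0 <= a <= K -> 0 <= b <= K -> 0 < eta ->
  mean (fun e => irg_edge_prob m w e.1 e.2) (edges n.+1)
    (fun A => `|n.+1%:R^-1 * (degree_pairs k.+1 l.+1 (graph_of A))%:R - q|) <=
  eta + `|a * b / m - q| +
  eta^-1 * (flip_bound k l ^+ 2 / n.+1%:R ^+ 2) * \sum_(e <- edges n.+1)
    w e.1 * w e.2 / (n.+1%:R * m) +
  flip_bound k l / n.+1%:R * \sum_(e <- edges n.+1)
    ((w e.1 - v e.1) * w e.2 + v e.1 * (w e.2 - v e.2)) / (n.+1%:R * m) +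
  B * (n.+1%:R^-1 + `|n.+1%:R^-1 * \sum_u v u - c * m| +
       `|weight_mean c v k - a| + `|weight_mean c v l - b|).
Proof.
have [B4 B40 hB4] := mean_degree_pairs_approx m0 c0 K0 k l.
pose C := flip_bound k l.
exists B4 => //.
move=> n w v a b q eta vE w0 Kn aK bK eta0.
have vK u : 0 <= v u <= K by rewrite vE; exact: truncate_itv.
set N : R := n.+1%:R.
have N0 : 0 < N by rewrite ltr0n.
have Ni : 0 <= N^-1 by rewrite invr_ge0 ltW.
have Nm0 : 0 < N * m by rewrite mulr_gt0.
set p := fun e : 'I_n.+1 * 'I_n.+1 => irg_edge_prob m w e.1 e.2.
have pge0 e : 0 <= p e.
  by rewrite /p /irg_edge_prob le_min ler01 andbT divr_ge0 ?(ltW Nm0)// mulr_ge0.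
have ple e : p e <= w e.1 * w e.2 / (N * m) by rewrite /p /irg_edge_prob ge_min
  lexx.
have p01 e : 0 <= p e <= 1 by rewrite pge0 /p /irg_edge_prob ge_min lexx orbT.
pose q01 := weight_edge_prob01 m0 vK Kn.
pose X (A : {set 'I_n.+1 * 'I_n.+1}) : R := N^-1 * (degree_pairs k.+1 l.+1
  (graph_of A))%:R.
have Xd : {in edges n.+1, forall e A, `|X (e |: A)%SET - X A| <= C / N}.
  move=> e _ A; rewrite /X -mulrBr normrM ger0_norm// mulrC ler_wpM2r//.
  exact: degree_pairs_add.
have C0 : 0 <= C by rewrite ler0n.
have CN0 : 0 <= C / N by rewrite mulr_ge0.
have hvar := mean_variance p01 Xd.
have hint := mean_interpolation p01 q01 CN0 Xd.
set MX := mean p (edges n.+1) X in hvar hint *.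
have -> : mean p (edges n.+1) (fun A => `|N^-1 * (degree_pairs k.+1 l.+1
  (graph_of A))%:R - q|)
  = mean p (edges n.+1) (fun A => `|X A - q|) by [].
have h1 : mean p (edges n.+1) (fun A => `|X A - q|) <=
    eta + eta^-1 * mean p (edges n.+1) (fun A => (X A - MX) ^+ 2) + `|MX - q|.
  rewrite -(mean_cst p (edges n.+1) eta) -meanZ -meanD -(mean_cst p (edges n.+1)
    `|MX - q|).
  rewrite -meanD; apply: le_mean => // A.
  rewrite (le_trans (ler_distD MX _ _))// lerD// mean_cst.
  exact: normr_le_AMGM.
have h2 : mean p (edges n.+1) (fun A => (X A - MX) ^+ 2) <=
    C ^+ 2 / N ^+ 2 * \sum_(e <- edges n.+1) w e.1 * w e.2 / (N * m).
  apply: le_trans hvar _; rewrite expr_div_n ler_wpM2l ?divr_ge0 ?sqr_ge0//.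
  exact: ler_sum.
have h3 : `|MX - a * b / m| <=
  C / N * \sum_(e <- edges n.+1)
    ((w e.1 - v e.1) * w e.2 + v e.1 * (w e.2 - v e.2)) / (N * m) +
  B4 * (N^-1 + `|N^-1 * \sum_u v u - c * m| +
       `|weight_mean c v k - a| + `|weight_mean c v l - b|).
  apply: le_trans (ler_distD (mean (weight_edge_prob m v) (edges n.+1) X) _ _) _.
  apply: lerD.
    apply: le_trans hint _; rewrite ler_wpM2l//.
    by apply: ler_sum => e _; rewrite vE; exact: irg_edge_prob_weight.
  by rewrite meanZ; exact: hB4.
have h4 := ler_distD (a * b / m) MX q.
have ei : 0 <= eta^-1 by rewrite invr_ge0 ltW.
have h5 := ler_wpM2l ei h2.
rewrite mulrA in h5.
have add4 (x e V P D T1 T2 T3 Q : R) : x <= e + V + P -> P <= D + Q ->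
  D <= T2 + T3 -> V <= T1 -> x <= e + Q + T1 + T2 + T3 by move=> *; lra.
exact: add4 h1 h4 h3 h5.
Qed.

End IrgDeviation.

(** * Independent copies of the weight *)

Local Open Scope classical_set_scope.

Section Copies.
Variables (R : realType) (d0 d : measure_display) (T0 : measurableType d0)
  (P0 : probability T0 R) (W : {RV P0 >-> R}) (T : measurableType d)
  (P : probability T R) (I : finType) (w : I -> {RV P >-> R}).
Hypothesis copies : iid_copies W w.

Let ge0E (f : R -> R) : (forall y, 0 <= f y) -> forall y, (0 <= (f y)%:E)%E.
Proof. by move=> f0 y; rewrite lee_fin. Qed.

Lemma integral_copy (f : R -> R) i : measurable_fun setT f -> (forall y,
  0 <= f y) ->
  (\int[P]_x (f (w i x))%:E = \int[P0]_x (f (W x))%:E)%E.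
Proof.
move=> mf f0; have mf' : measurable_fun setT (EFin \o f) by exact/measurable_EFinP.
rewrite -(ge0_integral_distribution (w i) mf' (ge0E f0)).
rewrite -(ge0_integral_distribution W mf' (ge0E f0)).
by apply: eq_measure_integral => A mA _; exact: copies.2.
Qed.

(** Independence on measurable rectangles identifies the joint law of two copies with the product
    measure; Tonelli then splits the integral. *)
Lemma integral_copy_pair (f g : R -> R) i j : i != j ->
    measurable_fun setT f -> (forall y, 0 <= f y) ->
    measurable_fun setT g -> (forall y, 0 <= g y) ->
  (\int[P]_x (f (w i x) * g (w j x))%:E =
   (\int[P0]_x (f (W x))%:E) * (\int[P0]_x (g (W x))%:E))%E.
Proof.
move=> ij mf f0 mg g0.
have mZ : measurable_fun setT (fun x => (w i x, w j x)).
  by apply: measurable_fun_pair; exact: measurable_funPT.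
pose Z_mixin := isMeasurableFun.Build _ _ _ _ _ mZ.
pose Z : {mfun T >-> (R * R)%type} := HB.pack (fun x => (w i x, w j x)) Z_mixin.
have mh : measurable_fun setT (fun z : R * R => (f z.1 * g z.2)%:E).
  apply/measurable_EFinP; apply: measurable_funM; apply: measurableT_comp => //.
have h0 (z : R * R) : (0 <= (f z.1 * g z.2)%:E)%E by rewrite lee_fin mulr_ge0.
have mf' : measurable_fun setT (EFin \o f) by exact/measurable_EFinP.
have mg' : measurable_fun setT (EFin \o g) by exact/measurable_EFinP.
transitivity (\int[distribution P Z]_z (f z.1 * g z.2)%:E)%E.
  by rewrite (ge0_integral_distribution Z mh h0).
transitivity (\int[distribution P (w i) \x distribution P (w j)]_z
    (f z.1 * g z.2)%:E)%E.
  apply: eq_measure_integral => A mA _; apply/esym.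
  apply: (product_measure_unique (m' := distribution P Z)) => //.
  move=> B C mB mC; rewrite /distribution /pushforward /=.
  pose D k := if k == i then B else C.
  have mD k : measurable (D k) by rewrite /D; case: ifP.
  have := copies.1 [set i; j]%SET D mD.
  rewrite big_setU1 ?big_set1 ?inE//= /D eqxx eq_sym (negbTE ij) => <-.
  congr (P _); apply/seteqP; split => [x [/= Bx Cx] k|x h].
    by rewrite /= !inE => /orP[]/eqP ->; rewrite ?eqxx// eq_sym (negbTE ij).
  split; first by have := h i; rewrite /= !inE !eqxx => /(_ isT).
  by have := h j; rewrite /= !inE !eqxx orbT eq_sym (negbTE ij) => /(_ isT).
rewrite fubini_tonelli1// /fubini_F /=.
transitivity (\int[distribution P (w i)]_x
    ((f x)%:E * \int[distribution P (w j)]_y (g y)%:E))%E.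
  by apply: eq_integral => x _; rewrite -ge0_integralZl_EFin// => y _; exact: ge0E.
rewrite ge0_integralZr//; last 2 first.
- by move=> x _; exact: ge0E.
- by apply: integral_ge0 => y _; exact: ge0E.
rewrite (ge0_integral_distribution (w i) mf' (ge0E f0)).
rewrite (ge0_integral_distribution (w j) mg' (ge0E g0)) /=.
by rewrite !integral_copy.
Qed.

End Copies.

Lemma measurable_EFin_comp (R : realType) (d : measure_display)
    (T : measurableType d) (D : set T) (f : T -> R) :
  measurable_fun D f -> measurable_fun D (fun x => (f x)%:E).
Proof. by move/measurable_EFinP. Qed.

Section ExpectationLe.
Variables (R : realType) (d : measure_display) (T : measurableType d)
  (P : probability T R).

(** Measurability and nonnegativity travel with the bound, so bounds can be added, scaled and summed
    with no separate integrability argument. *)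
Definition expect_le (f : T -> R) (r : R) : Prop :=
  [/\ measurable_fun setT f, forall x, 0 <= f x &
      (\int[P]_x (f x)%:E <= r%:E)%E].

Lemma expect_le_cst (r : R) : 0 <= r -> expect_le (fun=> r) r.
Proof.
move=> r0; split => //.
by rewrite integral_cst//= probability_setT mule1.
Qed.

Lemma expect_leD f g r s : expect_le f r -> expect_le g s ->
  expect_le (fun x => f x + g x) (r + s).
Proof.
move=> [mf f0 fr] [mg g0 gs]; split.
- exact: measurable_funD.
- by move=> x; rewrite addr_ge0.
- under eq_integral do rewrite EFinD.
  rewrite ge0_integralD//; first by rewrite EFinD leeD.
  + by move=> x _; rewrite lee_fin.
  + exact: measurable_EFin_comp.
  + by move=> x _; rewrite lee_fin.
  + exact: measurable_EFin_comp.
Qed.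

Lemma expect_leZ f (c r : R) : 0 <= c -> expect_le f r ->
  expect_le (fun x => c * f x) (c * r).
Proof.
move=> c0 [mf f0 fr]; split.
- exact: measurable_funM.
- by move=> x; rewrite mulr_ge0.
- under eq_integral do rewrite EFinM.
  rewrite ge0_integralZl_EFin//; first by rewrite EFinM lee_wpmul2l ?lee_fin.
  + by move=> x _; rewrite lee_fin.
  + exact: measurable_EFin_comp.
Qed.

Lemma expect_le_sum (J : eqType) (s : seq J) (f : J -> T -> R) (r : J -> R) :
    {in s, forall j, expect_le (f j) (r j)} ->
  expect_le (fun x => \sum_(j <- s) f j x) (\sum_(j <- s) r j).
Proof.
elim: s => [|j s IHs] fr.
  rewrite big_nil; under eq_fun do rewrite big_nil.
  exact: expect_le_cst.
rewrite big_cons; under eq_fun do rewrite big_cons.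
apply: expect_leD; first by apply: fr; rewrite mem_head.
by apply: IHs => i si; apply: fr; rewrite inE si orbT.
Qed.

Lemma expect_le_mono (f g : T -> R) r : measurable_fun setT f -> (forall x,
  0 <= f x) ->
  (forall x, f x <= g x) -> expect_le g r -> expect_le f r.
Proof.
move=> mf f0 fg [mg g0 gr]; split => //; apply: le_trans gr.
apply: ge0_le_integral => //.
- by move=> x _; rewrite lee_fin.
- exact: measurable_EFin_comp.
- exact: measurable_EFin_comp.
- by move=> x _; rewrite lee_fin.
Qed.

Lemma expect_le_trans f r s : expect_le f r -> r <= s -> expect_le f s.
Proof. by move=> [mf f0 fr] rs; split => //; rewrite (le_trans fr)// lee_fin. Qed.

End ExpectationLe.

(** * Pairwise laws of the weights and the weak law of large numbers *)

Section PairwiseCopies.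
Variables (R : realType) (d0 d : measure_display) (T0 : measurableType d0)
  (P0 : probability T0 R) (W : {RV P0 >-> R}) (T : measurableType d)
  (P : probability T R).

(** The interface through which the weights are used: one- and two-vertex laws tested on nonnegative
    functions, which is what second-moment computations call for. *)
Definition pairwise_copies (I : finType) (w : I -> T -> R) : Prop :=
  [/\ forall i, measurable_fun setT (w i), forall i x, 0 <= w i x,
      forall (f : R -> R) i, measurable_fun setT f -> (forall y, 0 <= f y) ->
        (\int[P]_x (f (w i x))%:E = \int[P0]_x (f (W x))%:E)%E &
      forall (f g : R -> R) i j, i != j ->
        measurable_fun setT f -> (forall y, 0 <= f y) ->
        measurable_fun setT g -> (forall y, 0 <= g y) ->
        (\int[P]_x (f (w i x) * g (w j x))%:E =
         (\int[P0]_x (f (W x))%:E) * (\int[P0]_x (g (W x))%:E))%E].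

Hypothesis W_ge0 : forall x, 0 <= W x.

(** A copy shares only the law of [W], so it is nonnegative merely almost surely. Its positive part
    is nonnegative everywhere and has the same law. *)
Lemma pairwise_copies_max (I : finType) (w : I -> {RV P >-> R}) :
  iid_copies W w -> pairwise_copies (fun i x => Num.max (w i x) 0).
Proof.
move=> cw.
have mmax : measurable_fun setT (fun y : R => Num.max y 0).
  by apply: measurable_maxr.
have mcomp f : measurable_fun setT f -> measurable_fun setT (fun y : R =>
  f (Num.max y 0) : R).
  by move=> mf; exact: (measurableT_comp mf mmax).
have WE (f : R -> R) : (\int[P0]_x (f (Num.max (W x) 0))%:E =
  \int[P0]_x (f (W x))%:E)%E.
  by apply: eq_integral => x _; rewrite max_l.
split.
- by move=> i; apply: (measurableT_comp mmax); exact: measurable_funPT.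
- by move=> i x; rewrite le_max lexx orbT.
- move=> f i mf f0; rewrite -WE.
  exact: (integral_copy cw i (mcomp _ mf) (fun y => f0 (Num.max y 0))).
- move=> f g i j ij mf f0 mg g0; rewrite -(WE f) -(WE g).
  exact: (integral_copy_pair cw ij (mcomp _ mf) (fun y => f0 (Num.max y 0))
    (mcomp _ mg) (fun y => g0 (Num.max y 0))).
Qed.

Lemma copy_ge0_ae (I : finType) (w : I -> {RV P >-> R}) (i : I) :
  iid_copies W w -> {ae P, forall x, 0 <= w i x}.
Proof.
move=> cw; exists (w i @^-1` [set y | y < 0]); split.
- rewrite -[X in measurable X]setTI; apply: (measurable_funPT (w i)) => //.
  by have := @measurable_itv R (`]-oo, 0[%R); rewrite set_itvE.
- have m0 : measurable [set y : R | y < 0].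
    by have := @measurable_itv R (`]-oo, 0[%R); rewrite set_itvE.
  rewrite -[LHS]/(distribution P (w i) _) cw.2// /distribution /pushforward.
  rewrite (_ : _ @^-1` _ = set0) ?measure0//; apply/seteqP; split => // x /=.
  by rewrite ltNge W_ge0.
- by move=> x /= /negP; rewrite -ltNge.
Qed.

Lemma weak_lln n (w : 'I_n.+1 -> T -> R) (f : R -> R) (M a eta : R) :
    pairwise_copies w -> measurable_fun setT f -> (forall y, 0 <= f y <= M) ->
    (\int[P0]_x (f (W x))%:E = a%:E)%E -> 0 < eta ->
  expect_le P (fun x => `|n.+1%:R^-1 * \sum_u f (w u x) - a|)
    (eta + eta^-1 * (M ^+ 2 / n.+1%:R)).
Proof.
move=> [mw w0 law1 law2] mf fM fa eta0.
have f0 y : 0 <= f y by case/andP: (fM y).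
have M0 : 0 <= M by apply: le_trans (f0 0) _; case/andP: (fM 0).
set N : R := n.+1%:R; have N0 : 0 < N by rewrite ltr0n.
have Ni : 0 <= N^-1 by rewrite invr_ge0 ltW.
have mfw u : measurable_fun setT (fun x => f (w u x)) by exact: measurableT_comp.
pose S x := N^-1 * \sum_u f (w u x).
have mS : measurable_fun setT S by apply: measurable_funM => //;
  exact: measurable_sum.
have S0 x : 0 <= S x by rewrite mulr_ge0// sumr_ge0.
have a0 : 0 <= a.
  by rewrite -lee_fin -fa; apply: integral_ge0 => x _; rewrite lee_fin.
have ES : (\int[P]_x (S x)%:E = a%:E)%E.
  under eq_integral do rewrite EFinM -sumEFin.
  rewrite ge0_integralZl_EFin//; last 2 first.
  - by move=> x _; apply: sume_ge0 => u _; rewrite lee_fin.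
  - by apply: emeasurable_sum => u; apply: measurable_EFin_comp.
  rewrite ge0_integral_sum//; last 2 first.
  - by move=> u; apply: measurable_EFin_comp.
  - by move=> u x _; rewrite lee_fin.
  rewrite (eq_bigr (fun=> a%:E)); last by move=> u _; rewrite law1.
  rewrite sumEFin -EFinM sumr_const card_ord -mulr_natl mulrA mulVf ?mul1r//.
  by rewrite gt_eqF.
have ES2 : expect_le P (fun x => S x ^+ 2) (M ^+ 2 / N + a ^+ 2).
  (* Off the diagonal the expectation is exactly a^2; on it M^2 is enough, and the extra a^2 only
     keeps the bound uniform in form. *)
  have pair u v : expect_le P (fun x => f (w u x) * f (w v x))
      ((u == v)%:R * M ^+ 2 + a ^+ 2).
    have mfg : measurable_fun setT (fun x => f (w u x) * f (w v x)).
      exact: measurable_funM.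
    have fg0 x : 0 <= f (w u x) * f (w v x) by rewrite mulr_ge0.
    have [_|uv] := eqVneq u v.
      apply: (expect_le_trans (r := M ^+ 2)); last by rewrite mul1r lerDl sqr_ge0.
      apply: expect_le_mono (expect_le_cst P (sqr_ge0 M)) => // x.
      by rewrite expr2 ler_pM//; [case/andP: (fM (w u x))|case/andP: (fM (w v x))].
    by split => //; rewrite law2// fa mul0r add0r -EFinM expr2.
  have h := expect_le_sum (s := index_enum _) (fun u _ =>
    expect_le_sum (s := index_enum _) (fun v _ => pair u v)).
  have := expect_leZ (sqr_ge0 N^-1) h.
  have -> : (fun x => N^-1 ^+ 2 * \sum_(j <- index_enum 'I_n.+1)
      \sum_(i <- index_enum 'I_n.+1) f (w j x) * f (w i x)) = (fun x => S x ^+ 2).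
    apply/funext => x; rewrite /S exprMn; congr (_ * _).
    by rewrite expr2 mulr_suml; apply: eq_bigr => u _; rewrite mulr_sumr.
  move=> /expect_le_trans; apply; rewrite le_eqVlt; apply/orP; left.
  rewrite (eq_bigr (fun=> M ^+ 2 + N * a ^+ 2)); last first.
    move=> u _; rewrite big_split /= sumr_const card_ord -mulr_natl; congr (_ + _).
    rewrite -mulr_suml (bigD1 u)//= eqxx big1 ?addr0 ?mul1r// => v.
    by rewrite eq_sym => /negbTE ->.
  rewrite sumr_const card_ord -mulr_natl -/N; apply/eqP; field.
  by rewrite gt_eqF.
have var : expect_le P (fun x => (S x - a) ^+ 2) (M ^+ 2 / N).
  have mv : measurable_fun setT (fun x => (S x - a) ^+ 2).
    by apply: measurable_funX; exact: measurable_funB.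
  split => //; first by move=> x; exact: sqr_ge0.
  have [_ _ h] := expect_leD ES2 (expect_le_cst P (sqr_ge0 a)).
  (* From (S - a)^2 + 2 a S = S^2 + a^2 and E[S] = a: the cross term is moved to the left so that
     only nonnegative functions are integrated. *)
  have : (\int[P]_x ((S x - a) ^+ 2)%:E + (2 * a ^+ 2)%:E <=
    (M ^+ 2 / N + a ^+ 2 + a ^+ 2)%:E)%E.
    apply: le_trans h.
    have -> : (2 * a ^+ 2)%:E = (\int[P]_x (2 * a * S x)%:E)%E.
      under eq_integral do rewrite EFinM.
      rewrite ge0_integralZl_EFin ?ES//; last 3 first.
      - by move=> x _; rewrite lee_fin.
      - exact: measurable_EFin_comp.
      - by rewrite mulr_ge0.
      by rewrite -EFinM expr2 mulrA.
    rewrite -ge0_integralD//; last 4 first.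
    - by move=> x _; rewrite lee_fin sqr_ge0.
    - exact: measurable_EFin_comp.
    - by move=> x _; rewrite lee_fin mulr_ge0// mulr_ge0.
    - by apply: measurable_EFin_comp; exact: measurable_funM.
    rewrite le_eqVlt; apply/orP; left; apply/eqP/eq_integral => x _.
    by rewrite -EFinD; congr EFin; ring.
  rewrite -leeBrDr// -EFinB => /le_trans; apply; rewrite lee_fin le_eqVlt.
  by apply/orP; left; apply/eqP; ring.
have ei : 0 <= eta^-1 by rewrite invr_ge0 ltW.
apply: expect_le_mono
  (expect_leD (expect_le_cst P (ltW eta0)) (expect_leZ ei var)) => //.
  by apply: measurableT_comp => //; exact: measurable_funB.
by move=> x; exact: normr_le_AMGM.
Qed.

End PairwiseCopies.

(** * Averages over the law of the random graph *)

Lemma measurable_mean (R : realType) (d : measure_display) (T : measurableType d)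
    (E : finType) (p : T -> E -> R) (s : seq E) (f : {set E} -> R) :
    (forall e, measurable_fun setT (fun x => p x e)) ->
  measurable_fun setT (fun x => mean (p x) s f).
Proof.
move=> mp; elim: s f => [|e s IHs] f /=; first exact: measurable_cst.
apply: measurable_funD; apply: measurable_funM => //.
by apply: measurable_funB.
Qed.

Lemma independent_edges_pmf_ge0 (R : realType) (n : nat) (p : 'I_n -> 'I_n -> R)
    (g : sgraph 'I_n) :
  (forall i j, 0 <= p i j <= 1) -> 0 <= independent_edges_pmf p g.
Proof.
move=> p01; apply: prodr_ge0 => e _; have /andP[p0 p1] := p01 e.1 e.2.
by case: ifP; rewrite // subr_ge0.
Qed.

Section GraphMean.
Variables (R : realType) (d : measure_display) (T : measurableType d)
  (P : probability T R) (n : nat) (G : T -> sgraph 'I_n.+1).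

(** Expectation of [f] at the random graph, as a finite sum over graphs: linear and monotone for
    real functions of any sign. *)
Definition graph_mean (f : sgraph 'I_n.+1 -> R) : R :=
  \sum_g fine (P (G @^-1` [set g])) * f g.

Lemma graph_meanD f g : graph_mean (fun h => f h + g h) =
  graph_mean f + graph_mean g.
Proof. by rewrite -big_split; apply: eq_bigr => h _; rewrite mulrDr. Qed.

Lemma graph_meanZ c f : graph_mean (fun h => c * f h) = c * graph_mean f.
Proof. by rewrite mulr_sumr; apply: eq_bigr => h _; rewrite mulrCA. Qed.

Lemma graph_mean_sum (J : Type) (s : seq J) (f : J -> sgraph 'I_n.+1 -> R) :
  graph_mean (fun h => \sum_(j <- s) f j h) = \sum_(j <- s) graph_mean (f j).
Proof. by rewrite exchange_big; apply: eq_bigr => h _; rewrite mulr_sumr. Qed.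

Lemma le_graph_mean f g : (forall h, f h <= g h) -> graph_mean f <= graph_mean g.
Proof. by move=> fg; apply: ler_sum => h _; rewrite ler_wpM2l// fine_ge0. Qed.

End GraphMean.

Section IrgMean.
Variables (R : realType) (d0 d : measure_display) (T0 : measurableType d0)
  (P0 : probability T0 R) (W : {RV P0 >-> R}) (T : measurableType d)
  (P : probability T R) (n : nat) (G : T -> sgraph 'I_n.+1).
Hypothesis W_ge0 : forall x, 0 <= W x.
Hypothesis G_irg : is_irg W P G.
Let m := fine 'E_P0[W].

Let m_ge0 : 0 <= m.
Proof. by apply: fine_ge0; apply: expectation_ge0. Qed.

Lemma irg_edge_prob01 (w : 'I_n.+1 -> R) i j :
  (forall u, 0 <= w u) -> 0 <= irg_edge_prob m w i j <= 1.
Proof.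
move=> w0; rewrite /irg_edge_prob le_min ler01 ge_min lexx orbT !andbT.
by rewrite divr_ge0 ?mulr_ge0.
Qed.

Lemma measurable_irg_edge_prob (w : 'I_n.+1 -> T -> R) i j :
  (forall u, measurable_fun setT (w u)) ->
  measurable_fun setT (fun x => irg_edge_prob m (fun u => w u x) i j).
Proof.
move=> mw; apply: (@measurable_minr _ _ _ _ (fun x =>
  w i x * w j x / (n.+1%:R * m)) (fun=> 1)) => //.
by apply: measurable_funM => //; exact: measurable_funM.
Qed.

Lemma measurable_irg_pmf (w : 'I_n.+1 -> T -> R) g :
  (forall u, measurable_fun setT (w u)) ->
  measurable_fun setT (fun x => independent_edges_pmf (irg_edge_prob m (fun u =>
    w u x)) g).
Proof.
move=> mw; rewrite (_ : (fun x => _) = (fun x => mean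
    (fun e => irg_edge_prob m (fun u => w u x) e.1 e.2) (edges n.+1)
    (fun A => (graph_of A == g)%:R))); last first.
  apply/funext => x.
  rewrite -(mean_graph_of (irg_edge_prob m (fun u => w u x)) (fun h => (h ==
    g)%:R)).
  rewrite (bigD1 g)//= eqxx mulr1 big1 ?addr0//.
  by move=> h /negbTE ->; rewrite mulr0.
by apply: measurable_mean => e; exact: measurable_irg_edge_prob.
Qed.

(** Taking the whole space as conditioning event gives the law of the graph as the weight average of
    the independent-edges law. The weights are replaced by their positive parts, which changes the
    integrand only on a null set. *)
Lemma irg_graph_mean : exists2 w : 'I_n.+1 -> T -> R, pairwise_copies W P w &
  forall f : sgraph 'I_n.+1 -> R, (forall g, 0 <= f g) ->
  (\int[P]_x (mean (fun e => irg_edge_prob m (fun u => w u x) e.1 e.2)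
     (edges n.+1) (fun A => f (graph_of A)))%:E = (graph_mean P G f)%:E)%E.
Proof.
have [mG [w cw Gw]] := G_irg.
have pw := pairwise_copies_max W_ge0 cw.
exists (fun i x => Num.max (w i x) 0) => // f f0.
set om := fun i x => Num.max (w i x) 0.
have [mom om0 _ _] := pw.
pose pm (v : 'I_n.+1 -> T -> R) g x := independent_edges_pmf (irg_edge_prob m
  (fun u => v u x)) g.
have Pg g : P (G @^-1` [set g]) = (\int[P]_x (pm om g x)%:E)%E.
  (* The whole space is in the generated sigma-algebra, as the complement of the empty set. *)
  have := Gw g setT; rewrite setTI => -> //; last first.
    by move=> M [[M0 MC _] _]; rewrite -(setD0 setT); exact: MC.
  apply: ae_eq_integral => //.
  - apply: measurable_EFin_comp; apply: measurable_irg_pmf => u.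
    exact: measurable_funPT.
  - by apply: measurable_EFin_comp; apply: measurable_irg_pmf.
  - have : {ae P, forall x, forall i, 0 <= w i x}.
      by apply: filter_forall => i; exact: copy_ge0_ae cw.
    apply: filterS => x wx _; rewrite /pm; congr ((independent_edges_pmf _ _)%:E).
    apply/funext => i; apply/funext => j.
    by rewrite /irg_edge_prob /om !max_l.
under eq_integral => x _ do
  rewrite -(mean_graph_of (irg_edge_prob m (fun u => om u x)) f) -sumEFin.
have pm0 g x : 0 <= pm om g x.
  by apply: independent_edges_pmf_ge0 => i j; apply: irg_edge_prob01 => u;
    exact: om0.
rewrite ge0_integral_sum//; last 2 first.
- move=> g; apply: measurable_EFin_comp; apply: measurable_funM => //.
  exact: measurable_irg_pmf.
- by move=> g x _; rewrite lee_fin; exact: mulr_ge0 (pm0 g x) (f0 g).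
rewrite /graph_mean -sumEFin; apply: eq_bigr => g _.
under eq_integral do rewrite mulrC EFinM.
rewrite ge0_integralZl_EFin//; last 2 first.
- by move=> x _; rewrite lee_fin; exact: (pm0 g x).
- by apply: measurable_EFin_comp; exact: measurable_irg_pmf.
rewrite -[X in (_ * X)%E]/(\int[P]_x (pm om g x)%:E)%E -Pg.
by rewrite -[in LHS](fineK (fin_num_measure P _ (mG g))) -EFinM mulrC.
Qed.

End IrgMean.

(** * Limiting constants *)

Lemma measurable_truncate (R : realType) (K : R) : measurable_fun setT (truncate K).
Proof.
apply: measurable_fun_if => //; first exact: measurable_fun_ler.
Qed.

Lemma measurable_poi (R : realType) (k : nat) : measurable_fun setT (@poi R k).
Proof.
apply: measurable_funM; first by apply: measurable_funM => //;
  exact: measurable_funX.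
apply: measurableT_comp => //.
Qed.

Lemma continuous_poi (R : realType) (k : nat) : continuous (@poi R k).
Proof.
move=> x; apply: cvgM.
  apply: cvgM; last exact: cvg_cst.
  exact: exprn_continuous.
apply: continuous_cvg; first exact: continuous_expR.
exact: cvgN.
Qed.

Section LimitConstants.
Variables (R : realType) (d0 : measure_display) (T0 : measurableType d0)
  (P0 : probability T0 R) (W : {RV P0 >-> R}).
Hypotheses (W_ge0 : forall x, 0 <= W x) (EW_gt0 : (0 < 'E_P0[W])%E)
  (EW_fin : ('E_P0[W] < +oo)%E).

(** The real value is the true integral as soon as |f y| <= y for y >= 0, by integrability of [W];
    see [weight_integralE]. *)
Definition weight_integral (f : R -> R) : R := fine (\int[P0]_x (f (W x))%:E)%E.

Let m := fine 'E_P0[W].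

Let EW : ('E_P0[W] = \int[P0]_x (W x)%:E)%E. Proof. by rewrite unlock. Qed.

Lemma fine_EW : ('E_P0[W] = m%:E)%E.
Proof. by rewrite fineK// ge0_fin_numE// ltW. Qed.

Lemma mean_weight_gt0 : 0 < m.
Proof. by rewrite -lte_fin -fine_EW. Qed.

Let W_int : P0.-integrable setT (fun x => (W x)%:E).
Proof.
apply/integrableP; split; first by apply: measurable_EFin_comp;
  exact: measurable_funPT.
by under eq_integral => x _ do rewrite /= ger0_norm//; rewrite -EW.
Qed.

Lemma weight_integralE (f : R -> R) : measurable_fun setT f ->
  (forall y, 0 <= y -> `|f y| <= y) ->
  (\int[P0]_x (f (W x))%:E = (weight_integral f)%:E)%E.
Proof.
move=> mf fW; rewrite fineK//; apply: integrable_fin_num => //.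
apply: le_integrable W_int => //.
  by apply: measurable_EFin_comp; apply: measurableT_comp => //;
    exact: measurable_funPT.
by move=> x _ /=; rewrite lee_fin (ger0_norm (W_ge0 x)) fW.
Qed.

Lemma weight_integral_id : weight_integral id = m.
Proof. by rewrite /weight_integral -EW. Qed.

Lemma weight_integral_cvg (f_ : nat -> R -> R) (f : R -> R) :
    (forall n, measurable_fun setT (f_ n)) -> measurable_fun setT f ->
    (forall n y, 0 <= y -> `|f_ n y| <= y) -> (forall y, 0 <= y -> `|f y| <= y) ->
    (forall y, 0 <= y -> f_ n y @[n --> \oo] --> f y) ->
  weight_integral (f_ n) @[n --> \oo] --> weight_integral f.
Proof.
move=> mf_ mf f_W fW f_f; apply: fine_cvg.
rewrite -weight_integralE//.
apply: (@dominated_cvg _ _ _ P0 setT measurableT (fun n x => (f_ n (W x))%:E) _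
  (fun x => (W x)%:E)) => //.
- by move=> n; apply: measurable_EFin_comp; exact: (measurableT_comp (mf_ n)
  (measurable_funPT W)).
- by move=> x _; apply: cvg_EFin; [exact: nearW|exact: f_f].
- by move=> n x _; rewrite lee_fin f_W.
Qed.

Definition truncated_mean (K : R) : R := weight_integral (truncate K).

(* The indices are shifted by one: this is a_(k+1). *)
Definition size_biased (k : nat) : R := weight_integral (fun y => y * poi k y).

Definition truncated_size_biased (K : R) (k : nat) : R :=
  weight_integral (fun y => truncate K y * poi k (truncate K y * (truncated_mean
    K / m))).

Let truncate_cvg (y : R) : \forall n \near \oo, truncate n%:R y = y.
Proof.
near=> n; rewrite /truncate ifT//; apply: ltW.
near: n; exact: nbhs_infty_gtr.
Unshelve. all: by end_near. Qed.

Let truncate_normr (K y : R) : 0 <= y -> `|truncate K y| <= y.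
Proof.
by move=> y0; rewrite ger0_norm; [exact: truncate_le|rewrite /truncate; case: ifP].
Qed.

Lemma truncated_mean_cvg : truncated_mean n%:R @[n --> \oo] --> m.
Proof.
rewrite -weight_integral_id; apply: weight_integral_cvg => //.
- by move=> n; exact: measurable_truncate.
- by move=> n y; exact: truncate_normr.
- by move=> y y0; rewrite ger0_norm.
- by move=> y y0; apply: cvg_near_cst; exact: truncate_cvg.
Qed.

Lemma truncated_mean_ge0 K : 0 <= truncated_mean K.
Proof.
apply: fine_ge0; apply: integral_ge0 => x _; rewrite lee_fin /truncate.
by case: ifP.
Qed.

Lemma measurable_size_biased (K c : R) k :
  measurable_fun setT (fun y => truncate K y * poi k (truncate K y * c)).
Proof.
apply: measurable_funM; first exact: measurable_truncate.
apply: measurableT_comp; first exact: measurable_poi.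
by apply: measurable_funM => //; exact: measurable_truncate.
Qed.

Lemma mul_poi_normr (y t : R) k : 0 <= y -> 0 <= t -> `|y * poi k t| <= y.
Proof.
move=> y0 t0; have h := poi_ge0 k t0; rewrite ger0_norm; last exact: mulr_ge0.
by rewrite -[leRHS]mulr1 ler_wpM2l// poi_le1.
Qed.

(** Dominated convergence under [W]: at a fixed weight the truncation is eventually inactive, and
    the rate y c tends to y because the truncated means tend to [m]. *)
Lemma truncated_size_biased_cvg k :
  truncated_size_biased n%:R k @[n --> \oo] --> size_biased k.
Proof.
have c0 K : 0 <= truncated_mean K / m.
  by rewrite divr_ge0 ?truncated_mean_ge0// ltW// mean_weight_gt0.
apply: weight_integral_cvg.
- by move=> n; exact: measurable_size_biased.
- by apply: measurable_funM => //; exact: measurable_poi.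
- move=> n y y0; have t0 : 0 <= truncate n%:R y by rewrite /truncate; case: ifP.
  apply: le_trans (truncate_normr n%:R y0); rewrite (ger0_norm t0).
  by apply: mul_poi_normr => //; rewrite mulr_ge0.
- by move=> y y0; exact: mul_poi_normr.
- move=> y y0.
  have h : y * poi k (y * (truncated_mean n%:R / m)) @[n --> \oo] --> y * poi k y.
    apply: cvgM; first exact: cvg_cst.
    apply: continuous_cvg; first exact: continuous_poi.
    rewrite -[X in _ --> X]mulr1; apply: cvgM; first exact: cvg_cst.
    rewrite -[X in _ --> X](@divff _ m) ?gt_eqF ?mean_weight_gt0//.
    by apply: cvgM; [exact: truncated_mean_cvg|exact: cvg_cst].
  apply: cvg_trans h; apply: near_eq_cvg; near=> n.
  rewrite (_ : truncate n%:R y = y)//.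
  by near: n; exact: truncate_cvg.
Unshelve. all: by end_near. Qed.

End LimitConstants.

(** * Limit in mean of the pair counts *)

Section DegreePairsLimit.
Variables (R : realType) (d0 : measure_display) (T0 : measurableType d0)
  (P0 : probability T0 R) (W : {RV P0 >-> R}).
Hypotheses (W_ge0 : forall x, 0 <= W x) (EW_gt0 : (0 < 'E_P0[W])%E)
  (EW_fin : ('E_P0[W] < +oo)%E).

Let m := fine 'E_P0[W].
Let m_gt0 : 0 < m. Proof. exact: mean_weight_gt0. Qed.

Lemma weight_integral_itv (K : R) (f : R -> R) : 0 <= K ->
    measurable_fun setT f -> (forall y, 0 <= y -> 0 <= f y <= K) ->
    (forall y, 0 <= y -> f y <= y) ->
  0 <= weight_integral W f <= K.
Proof.
move=> K0 mf fK fy.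
have f0 x : 0 <= f (W x) by have /andP[] := fK _ (W_ge0 x).
rewrite -!lee_fin -weight_integralE//; last first.
  by move=> y y0; have /andP[fy0 _] := fK _ y0; rewrite ger0_norm// fy.
rewrite integral_ge0//=; last by move=> x _; rewrite lee_fin.
have [_ _] := expect_le_cst P0 K0; apply: le_trans.
apply: ge0_le_integral => //.
- by move=> x _; rewrite lee_fin.
- by apply: measurable_EFin_comp; exact: (measurableT_comp mf (measurable_funPT W)).
- by move=> x _; rewrite lee_fin; have /andP[] := fK _ (W_ge0 x).
Qed.

Lemma weight_integral_truncated (K : R) :
  weight_integral W (fun y => y - truncate K y) = m - truncated_mean W K.
Proof.
have mt := measurable_truncate K.
have t0 y : 0 <= y -> 0 <= truncate K y by rewrite /truncate; case: ifP.
have d0' y : 0 <= y -> 0 <= y - truncate K y by move=> y0;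
  rewrite subr_ge0 truncate_le.
have md : measurable_fun setT (fun y : R => y - truncate K y) by exact:
  measurable_funB.
have mW := measurable_funPT W.
suff <- : weight_integral W (fun y => y - truncate K y) + truncated_mean W K = m.
  by rewrite addrK.
apply: EFin_inj; rewrite EFinD -!weight_integralE//; first last.
- by move=> y y0; rewrite ger0_norm ?d0'// lerBlDr lerDl t0.
- by move=> y y0; rewrite ger0_norm ?t0// truncate_le.
rewrite -ge0_integralD//; first last.
- by apply: measurable_EFin_comp; exact: (measurableT_comp mt mW).
- by move=> x _; rewrite lee_fin t0.
- by apply: measurable_EFin_comp; exact: (measurableT_comp md mW).
- by move=> x _; rewrite lee_fin d0'.
rewrite -(fine_EW EW_gt0 EW_fin) unlock; apply: eq_integral => x _.
by rewrite -EFinD subrK.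
Qed.

Section WeightExpectations.
Variables (d : measure_display) (T : measurableType d) (P : probability T R)
  (n : nat) (w : 'I_n.+1 -> T -> R).
Hypothesis pw : pairwise_copies W P w.

(** The test functions below are controlled only on y >= 0, whereas [pairwise_copies] asks for
    nonnegativity on the whole line; composing with [pos] reconciles the two. *)
Let pos (y : R) := Num.max y 0.

Let mpos : measurable_fun setT pos. Proof. exact: measurable_maxr. Qed.

Let pos_ge0 y : 0 <= pos y. Proof. by rewrite /pos le_max lexx orbT. Qed.

Let pos_weight i x : pos (w i x) = w i x.
Proof. by rewrite /pos max_l//; case: pw. Qed.

Lemma expect_le_pair (f g : R -> R) i j : i != j ->
    measurable_fun setT f -> measurable_fun setT g ->
    (forall y, 0 <= y -> 0 <= f y <= y) -> (forall y, 0 <= y -> 0 <= g y <= y) ->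
  expect_le P (fun x => f (w i x) * g (w j x))
    (weight_integral W f * weight_integral W g).
Proof.
move=> ij mf mg f0 g0; have [mw w0 _ law2] := pw.
have fE (h : R -> R) : (forall y, 0 <= y -> 0 <= h y <= y) ->
  measurable_fun setT h ->
    (\int[P0]_x (h (pos (W x)))%:E = (weight_integral W h)%:E)%E.
  move=> h0 mh; rewrite -weight_integralE//.
    by apply: eq_integral => x _; rewrite /pos max_l.
  by move=> y y0; have /andP[hy0 hy] := h0 _ y0; rewrite ger0_norm.
split.
- apply: measurable_funM.
    exact: (measurableT_comp mf (mw i)).
  exact: (measurableT_comp mg (mw j)).
- move=> x; have /andP[? _] := f0 _ (w0 i x); have /andP[? _] := g0 _ (w0 j x).
  exact: mulr_ge0.
- have := law2 (f \o pos) (g \o pos) i j ij (measurableT_comp mf mpos)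
    (fun y => proj1 (andP (f0 _ (pos_ge0 y)))) (measurableT_comp mg mpos)
    (fun y => proj1 (andP (g0 _ (pos_ge0 y)))).
  under eq_integral do rewrite /= !pos_weight.
  by move=> ->; rewrite /comp !fE// -EFinM.
Qed.

Lemma expect_le_edges (f : R -> R -> R) (r : R) : 0 <= r ->
    (forall i j, i != j -> expect_le P (fun x => f (w i x) (w j x)) r) ->
  expect_le P (fun x => \sum_(e <- edges n.+1) f (w e.1 x) (w e.2 x)
    / (n.+1%:R * m))
    (n.+1%:R * (r / m)).
Proof.
move=> r0 fr; have N0 : 0 < n.+1%:R :> R by rewrite ltr0n.
have Nm : 0 <= (n.+1%:R * m)^-1 by rewrite invr_ge0 mulr_ge0// ltW.
have h : {in edges n.+1, forall e, expect_le P
    (fun x => f (w e.1 x) (w e.2 x) / (n.+1%:R * m)) (r / (n.+1%:R * m))}.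
  move=> e; rewrite mem_edges => e12; rewrite [r / _]mulrC.
  rewrite (_ : (fun x => _) = (fun x => (n.+1%:R * m)^-1 * f (w e.1 x)
    (w e.2 x))); last first.
    by apply/funext => x; rewrite mulrC.
  apply: expect_leZ => //; apply: fr.
  by rewrite neq_ltn e12.
apply: expect_le_trans (expect_le_sum h) _.
rewrite big_const_seq iter_addr_0 count_predT -[leLHS]mulr_natl.
apply: (@le_trans _ _ ((n.+1%:R * n.+1%:R) * (r / (n.+1%:R * m)))).
  rewrite ler_wpM2r ?mulr_ge0// -natrM ler_nat /edges -cardE.
  by apply: leq_trans (max_card _) _; rewrite card_prod card_ord.
rewrite le_eqVlt; apply/orP; left; apply/eqP; field.
by rewrite !gt_eqF.
Qed.

Lemma weak_lln_truncated (K eta : R) (f : R -> R) : 0 <= K -> 0 < eta ->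
    measurable_fun setT f -> (forall y, 0 <= y -> 0 <= f y <= K) ->
    (forall y, 0 <= y -> f y <= y) ->
  expect_le P (fun x => `|n.+1%:R^-1 * \sum_u f (w u x) - weight_integral W f|)
    (eta + eta^-1 * (K ^+ 2 / n.+1%:R)).
Proof.
move=> K0 eta0 mf fK fy.
rewrite (_ : (fun x => _) = (fun x =>
    `|n.+1%:R^-1 * \sum_u (f \o pos) (w u x) - weight_integral W f|)); last first.
  apply/funext => x; congr (`|_ * _ - _|).
  by apply: eq_bigr => u _; rewrite /= pos_weight.
apply: (weak_lln pw (measurableT_comp mf mpos)) => //.
  by move=> y; exact: fK.
rewrite -weight_integralE//; first by apply: eq_integral => x _;
  rewrite /= /pos max_l.
by move=> y y0; have /andP[f0 _] := fK _ y0; rewrite ger0_norm// fy.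
Qed.

End WeightExpectations.

(** The threshold [n0] precedes the probability space, since each graph of the sequence may live on
    its own. The constants are chosen in the order K, B, eta', n0; five errors of at most eps/6 add
    up. *)
Lemma degree_pairs_limit k l (eps : R) : 0 < eps -> exists n0 : nat,
  forall n, (n0 <= n)%N -> forall (d : measure_display) (T : measurableType d)
    (P : probability T R) (G : T -> sgraph 'I_n.+1), is_irg W P G ->
  graph_mean P G (fun g => `|n.+1%:R^-1 * (degree_pairs k.+1 l.+1 g)%:R -
    size_biased W k * size_biased W l / m|) <= eps.
Proof.
move=> eps0; set q := size_biased W k * size_biased W l / m.
pose C := flip_bound R k l.
have C0 : 0 <= C by rewrite ler0n.
have e6 : 0 < eps / 6 by lra.
have hq : truncated_size_biased W n%:R k * truncated_size_biased W n%:R l / m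
    @[n --> \oo] --> q.
  by apply: cvgM; [apply: cvgM; exact: truncated_size_biased_cvg|exact: cvg_cst].
have hm : C * (1 + truncated_mean W n%:R / m) * (m - truncated_mean W n%:R)
    @[n --> \oo] --> 0.
  have tc : truncated_mean W n%:R @[n --> \oo] --> m by exact: truncated_mean_cvg.
  rewrite -(mulr0 (C * (1 + m / m))); apply: cvgM.
    apply: cvgM; [exact: cvg_cst|apply: cvgD; first exact: cvg_cst].
    by apply: cvgM => //; exact: cvg_cst.
  rewrite -(subrr m); apply: cvgB => //; exact: cvg_cst.
(* The two errors that do not vanish with the number of vertices: the distance between the truncated
   and the true limit, and the expected cost of truncating the edge probabilities. *)
have [K0 _ hK0] : \forall n \near \oo, eps / 6 >= 
    `|truncated_size_biased W n%:R k * truncated_size_biased W n%:R l / m - q| /\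
    C * (1 + truncated_mean W n%:R / m) * (m - truncated_mean W n%:R) <= eps / 6.
  near=> n; split.
    rewrite distrC; near: n; move/cvgrPdist_le: hq; exact.
  apply: le_trans (ler_norm _) _; rewrite -normrN -[- _]sub0r.
  by near: n; move/cvgrPdist_le: hm; exact.
have /= [hK1 hK2] := hK0 K0 (leqnn K0).
set K : R := K0%:R in hK1 hK2.
have K_ge0 : 0 <= K by rewrite ler0n.
set a := truncated_size_biased W K k in hK1; set b :=
  truncated_size_biased W K l in hK1.
set mK := truncated_mean W K in hK2; pose c := mK / m.
have mK0 : 0 <= mK by exact: truncated_mean_ge0.
have c0 : 0 <= c by rewrite divr_ge0// ltW.
have [B B0 hB] := mean_degree_pairs_deviation m_gt0 c0 K_ge0 k l.
pose eta := eps / 6.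
(* Three weak laws (mean weight, index k, index l) each contribute B eta', hence 18 = 3 * 6; adding
   1 to [B] keeps the denominator positive. *)
pose eta' := eps / (18 * (B + 1)).
have eta'0 : 0 < eta' by rewrite divr_gt0// mulr_gt0//; lra.
have Beta : B * (3 * eta') <= eps / 6.
  rewrite /eta' (_ : B * (3 * _) = (B / (B + 1)) * (eps / 6)).
    rewrite ler_piMl//; first lra.
    by rewrite ler_pdivrMr ?mul1r; lra.
  by field; apply/eqP; lra.
(* Everything of order 1/N: the variance term, the explicit 1/N of the approximation and the three
   weak-law variances. *)
pose A := eta^-1 * C ^+ 2 * m + B * (1 + 3 * (eta'^-1 * K ^+ 2)).
have ei : 0 <= eta^-1 by rewrite invr_ge0 ltW.
have ei' : 0 <= eta'^-1 by rewrite invr_ge0 ltW.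
have A0 : 0 <= A.
  by rewrite addr_ge0// mulr_ge0// ?(ltW m_gt0)// ?mulr_ge0 ?sqr_ge0// addr_ge0//
    mulr_ge0// mulr_ge0 ?sqr_ge0.
(* N = n + 1 exceeds this real number; its two summands ensure K^2 <= N m and A/N <= eps/6. *)
exists (Num.trunc (K ^+ 2 / m + 6 * A / eps)) => n n0n d T P G irgG.
set N : R := n.+1%:R.
have N0 : 0 < N by rewrite ltr0n.
have NA : K ^+ 2 / m + 6 * A / eps <= N.
  have h : 0 <= K ^+ 2 / m + 6 * A / eps.
    by rewrite addr_ge0// divr_ge0 ?sqr_ge0 ?mulr_ge0// ltW.
  have := Num.Theory.truncnS_gt (K ^+ 2 / m + 6 * A / eps) => /ltW /le_trans; apply.
  by rewrite ler_nat ltnS.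
have KN : K ^+ 2 <= N * m.
  rewrite -ler_pdivrMr//; apply: le_trans NA; rewrite lerDl.
  by rewrite divr_ge0 ?mulr_ge0// ltW.
have AN : A / N <= eps / 6.
  have : 6 * A / eps <= N by apply: le_trans NA;
    rewrite lerDr divr_ge0 ?sqr_ge0// ltW.
  rewrite ler_pdivrMr// => h; rewrite ler_pdivrMr//; lra.
have [w pw hw] := irg_graph_mean W_ge0 irgG.
have [mw w0 _ _] := pw.
rewrite -lee_fin -hw//.
suff [] : expect_le P (fun x => mean (fun e =>
    irg_edge_prob m (fun u => w u x) e.1 e.2) (edges n.+1)
    (fun A => `|n.+1%:R^-1 * (degree_pairs k.+1 l.+1 (graph_of A))%:R - q|))
      eps by [].
have t0 y : 0 <= y -> 0 <= truncate K y by rewrite /truncate; case: ifP.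
have t01 y : 0 <= y -> 0 <= truncate K y <= K by move=> y0; exact: truncate_itv.
have tc0 y : 0 <= y -> 0 <= truncate K y * c by move=> y0; rewrite mulr_ge0 ?t0.
have tp01 j y : 0 <= y -> 0 <= truncate K y * poi j (truncate K y * c) <= K.
  move=> y0; have /andP[h0 h1] := t01 _ y0; have h := poi_ge0 j (tc0 _ y0).
  rewrite mulr_ge0//=; apply: le_trans h1.
  by rewrite -[leRHS]mulr1 ler_wpM2l// poi_le1// tc0.
have tpy j y : 0 <= y -> truncate K y * poi j (truncate K y * c) <= y.
  move=> y0; apply: le_trans (truncate_le K y0).
  by rewrite -[leRHS]mulr1 ler_wpM2l ?t0// poi_le1// tc0.
have mt := measurable_truncate K.
have mtp j := measurable_size_biased K c j.
have aK : 0 <= a <= K by apply: weight_integral_itv (mtp k) (tp01 k) (tpy k).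
have bK : 0 <= b <= K by apply: weight_integral_itv (mtp l) (tp01 l) (tpy l).
have hx x := hB n (fun u => w u x) (truncate K \o (fun u => w u x)) a b q eta erefl
  (fun u => w0 u x) KN aK bK e6.
have itv_id y : 0 <= y -> 0 <= y <= y by move=> ->; exact: lexx.
have itv_t y : 0 <= y -> 0 <= truncate K y <= y by move=> y0;
  rewrite t0// truncate_le.
have itv_d y : 0 <= y -> 0 <= y - truncate K y <= y.
  by move=> y0; rewrite subr_ge0 truncate_le//= lerBlDr lerDl t0.
have md : measurable_fun setT (fun y : R => y - truncate K y) by exact:
  measurable_funB.
have wm : weight_integral W id = m := weight_integral_id W.
have tau0 : 0 <= m - mK.
  rewrite -weight_integral_truncated; apply: fine_ge0; apply: integral_ge0 => x _.
  by rewrite lee_fin; have /andP[] := itv_d _ (W_ge0 x).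
have E1 : expect_le P (fun x => \sum_(e <- edges n.+1) w e.1 x * w e.2 x / (N * m))
    (N * (m * m / m)).
  apply: (expect_le_edges (f := fun y z => y * z)).
    by rewrite mulr_ge0 ?(ltW m_gt0).
  move=> i j ij; rewrite -wm.
  apply: (@expect_le_pair _ _ _ _ _ pw id id) => //; exact: itv_id.
have E2 : expect_le P (fun x => \sum_(e <- edges n.+1)
    ((w e.1 x - truncate K (w e.1 x)) * w e.2 x +
     truncate K (w e.1 x) * (w e.2 x - truncate K (w e.2 x))) / (N * m))
    (N * (((m - mK) * m + mK * (m - mK)) / m)).
  apply: (expect_le_edges
    (f := fun y z => (y - truncate K y) * z + truncate K y * (z - truncate K z))).
    by rewrite addr_ge0 ?mulr_ge0 ?(ltW m_gt0).
  move=> i j ij; rewrite -weight_integral_truncated.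
  apply: expect_leD.
    rewrite -[X in _ * X]wm.
    apply: (@expect_le_pair _ _ _ _ _ pw (fun y => y - truncate K y) id) => //;
      exact: itv_id.
  exact: (expect_le_pair pw ij mt md itv_t itv_d).
have E3 : expect_le P (fun x => `|N^-1 * \sum_u truncate K (w u x) - c * m|)
    (eta' + eta'^-1 * (K ^+ 2 / N)).
  rewrite /c divfK ?gt_eqF//.
  apply: (weak_lln_truncated pw K_ge0 eta'0 mt t01) => y y0; exact: truncate_le.
have E4 j : expect_le P (fun x => `|weight_mean c (fun u => truncate K (w u x)) j -
    truncated_size_biased W K j|) (eta' + eta'^-1 * (K ^+ 2 / N)).
  exact: (weak_lln_truncated pw K_ge0 eta'0 (mtp j) (tp01 j) (tpy j)).
have Ni : 0 <= N^-1 by rewrite invr_ge0 ltW.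
have c1 : 0 <= eta^-1 * (C ^+ 2 / N ^+ 2) by rewrite mulr_ge0// divr_ge0 ?sqr_ge0.
have c2 : 0 <= C / N by rewrite mulr_ge0.
have total := expect_leD (expect_leD (expect_leD (expect_leD
    (expect_le_cst P (ltW e6)) (expect_le_cst P (normr_ge0 (a * b / m - q))))
    (expect_leZ c1 E1)) (expect_leZ c2 E2))
    (expect_leZ B0 (expect_leD (expect_leD (expect_leD
      (expect_le_cst P Ni) E3) (E4 k)) (E4 l))).
apply: expect_le_trans (expect_le_mono _ _ hx total) _.
- by apply: measurable_mean => e; exact: measurable_irg_edge_prob.
- by move=> x; apply: mean_ge0 => // e; apply: irg_edge_prob01 => u.
have -> : eta^-1 * (C ^+ 2 / N ^+ 2) * (N * (m * m / m)) = eta^-1 * C ^+ 2 * m / N.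
  by field; rewrite !gt_eqF.
have -> : C / N * (N * (((m - mK) * m + mK * (m - mK)) / m)) =
    C * (1 + mK / m) * (m - mK) by field; rewrite !gt_eqF.
move: AN; rewrite /A mulrDl.
have -> : B * (N^-1 + (eta' + eta'^-1 * (K ^+ 2 / N))
  + (eta' + eta'^-1 * (K ^+ 2 / N))
   + (eta' + eta'^-1 * (K ^+ 2 / N))) =
  B * (3 * eta') + B * (1 + 3 * (eta'^-1 * K ^+ 2)) / N by ring.
have sum5 (x1 x2 x3 x4 x5 : R) : x1 + x2 <= eps / 6 -> x3 <= eps / 6 ->
    x4 <= eps / 6 -> x5 <= eps / 6 -> eps / 6 + x3 + x1 + x4 + (x5 + x2) <= eps.
  by move=> *; lra.
by move=> /sum5; exact.
Unshelve. all: by end_near. Qed.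

End DegreePairsLimit.

(** * Poisson series and their integrals against the law of the weight *)

Lemma poi_sum_cvg (R : realType) (x : R) :
  \sum_(0 <= k < n) poi k x @[n --> \oo] --> (1 : R).
Proof.
have h : series (exp_coeff x) n * expR (- x) @[n --> \oo] -->
  (expR x * expR (- x) : R).
  by apply: cvgM; [exact: is_cvg_series_exp_coeff|exact: cvg_cst].
rewrite expRN mulfV ?gt_eqF ?expR_gt0// in h.
apply: cvg_trans h; apply: near_eq_cvg; apply: nearW => n.
by rewrite /series /= mulr_suml; apply: eq_bigr => k _; rewrite /poi expRN.
Qed.

(** Split k + 1 into 1 and k, and shift the second part with [poiS]. In the limit this is the mean 1
    + x of one plus a Poisson(x) variable. *)
Lemma poi_mean_sum (R : realType) (x : R) n :
  \sum_(0 <= k < n.+1) k.+1%:R * poi k x =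
  \sum_(0 <= k < n.+1) poi k x + x * \sum_(0 <= k < n) poi k x.
Proof.
rewrite (eq_bigr (fun k => poi k x + k%:R * poi k x)); last first.
  by move=> k _; rewrite -natr1 mulrDl mul1r addrC.
rewrite big_split /=; congr (_ + _).
rewrite big_nat_recl// mul0r add0r mulr_sumr.
by apply: eq_bigr => k _; rewrite poiS.
Qed.

Lemma poi_mean_sum_cvg (R : realType) (x : R) :
  \sum_(0 <= k < n) k.+1%:R * poi k x @[n --> \oo] --> (1 + x : R).
Proof.
rewrite -cvg_shiftS /=.
have h1 : \sum_(0 <= k < n.+1) poi k x @[n --> \oo] --> (1 : R).
  by have := @poi_sum_cvg R x; rewrite -cvg_shiftS.
have h : \sum_(0 <= k < n.+1) poi k x + x * \sum_(0 <= k < n) poi k x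
    @[n --> \oo] --> (1 + x * 1 : R).
  by apply: cvgD => //; apply: cvgM; [exact: cvg_cst|exact: poi_sum_cvg].
rewrite mulr1 in h; apply: cvg_trans h; apply: near_eq_cvg; apply: nearW => n.
by rewrite poi_mean_sum.
Qed.

Section SizeBiasedSums.
Variables (R : realType) (d0 : measure_display) (T0 : measurableType d0)
  (P0 : probability T0 R) (W : {RV P0 >-> R}).
Hypotheses (W_ge0 : forall x, 0 <= W x) (EW_gt0 : (0 < 'E_P0[W])%E)
  (EW_fin : ('E_P0[W] < +oo)%E).

Let mpoi k : measurable_fun setT (fun y : R => y * poi k y).
Proof. by apply: measurable_funM => //; exact: measurable_poi. Qed.

Let poi_normr k (y : R) : 0 <= y -> `|y * poi k y| <= y.
Proof. by move=> y0; exact: mul_poi_normr. Qed.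

Let poiW_ge0 k x : 0 <= W x * poi k (W x).
Proof. by rewrite mulr_ge0 ?poi_ge0. Qed.

Let mpoiW k : measurable_fun setT (fun x => W x * poi k (W x)).
Proof. exact: (measurableT_comp (mpoi k) (measurable_funPT W)). Qed.

Lemma size_biased_ge0 k : 0 <= size_biased W k.
Proof. by apply: fine_ge0; apply: integral_ge0 => x _; rewrite lee_fin. Qed.

(** This keeps the limiting denominator of the ANND away from 0. Since y * poi k y vanishes only at
    y = 0, a zero integral would force W = 0 almost surely. *)
Lemma size_biased_gt0 k : 0 < size_biased W k.
Proof.
rewrite lt_neqAle size_biased_ge0 andbT eq_sym; apply/eqP => a0.
have : (\int[P0]_x `|(W x * poi k (W x))%:E| = 0)%E.
  under eq_integral => x _ do rewrite /= ger0_norm//.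
  by rewrite (weight_integralE W_ge0 EW_fin (mpoi k) (poi_normr k))
    -/(size_biased W k) a0.
move/(ae_eq_integral_abs _ measurableT) => /(_ (measurable_EFin_comp (mpoiW k)))
  ae0.
suff : ('E_P0[W] = 0)%E by move=> E0; move: EW_gt0; rewrite E0 ltxx.
rewrite unlock -[RHS](integral0 P0 setT); apply: ae_eq_integral => //.
  by apply: measurable_EFin_comp; exact: measurable_funPT.
apply: filterS ae0 => x /(_ Logic.I) /= [] /eqP.
rewrite mulf_eq0 => /orP[/eqP -> //|]; rewrite /poi mulf_eq0 (gt_eqF (expR_gt0
  _)) orbF.
rewrite mulf_eq0 invr_eq0 pnatr_eq0 (gtn_eqF (fact_gt0 k)) orbF expf_eq0.
by move=> /andP[_ /eqP ->].
Qed.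

(** Monotone convergence, stated in the extended reals so that it applies while the limit may still
    be infinite. *)
Lemma size_biased_sum_cvg (c : nat -> R) (s : R -> R) :
    (forall k, 0 <= c k) ->
    (forall y, 0 <= y -> \sum_(0 <= k < n) c k * poi k y @[n --> \oo] --> s y) ->
  ((\sum_(0 <= k < n) c k * size_biased W k)%:E @[n --> \oo] -->
   \int[P0]_x (W x * s (W x))%:E)%E.
Proof.
move=> c0 cs.
pose g n x := (W x * \sum_(0 <= k < n) c k * poi k (W x))%:E.
have gE n x : W x * \sum_(0 <= k < n) c k * poi k (W x) =
    \sum_(0 <= k < n) c k * (W x * poi k (W x)).
  by rewrite mulr_sumr; apply: eq_bigr => k _; rewrite mulrCA.
have mg n : measurable_fun setT (g n).
  apply: measurable_EFin_comp; rewrite (_ : (fun x => _) =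
    (fun x => \sum_(0 <= k < n) c k * (W x * poi k (W x))));
      last by apply/funext => x.
  by apply: measurable_sum => k; exact: measurable_funM.
have g0 n x : (0 <= g n x)%E.
  by rewrite lee_fin gE sumr_ge0// => k _; rewrite mulr_ge0.
have ndg x : {homo g^~ x : n p / (n <= p)%N >-> (n <= p)%E}.
  move=> n p np; rewrite lee_fin !gE (big_cat_nat (leq0n n) np)//=.
  by rewrite lerDl sumr_ge0// => k _; rewrite mulr_ge0.
have -> : (\int[P0]_x (W x * s (W x))%:E = \int[P0]_x limn (g ^~ x))%E.
  apply: eq_integral => x _; apply/esym/cvg_lim => //; apply: cvg_EFin;
    first exact: nearW.
  by apply: cvgM; [exact: cvg_cst|exact: cs].
apply: cvg_trans (cvg_monotone_convergence measurableT mg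
  (fun n x _ => g0 n x) (fun x _ => ndg x)).
apply: near_eq_cvg; apply: nearW => n; rewrite /g /=.
 under eq_integral => x _ do rewrite gE -sumEFin.
rewrite ge0_integral_sum//; last 2 first.
- by move=> k; apply: measurable_EFin_comp; exact: measurable_funM.
- by move=> k x _; rewrite lee_fin mulr_ge0.
rewrite -sumEFin; apply: eq_bigr => k _.
under eq_integral do rewrite EFinM.
rewrite ge0_integralZl_EFin//; last 2 first.
- by move=> x _; rewrite lee_fin.
- exact: measurable_EFin_comp.
by rewrite (weight_integralE W_ge0 EW_fin (mpoi k) (@poi_normr k)) -EFinM.
Qed.

End SizeBiasedSums.

(** * Uniform integrability *)

(** The integrand takes finitely many values: it is expanded over the events that fix both the graph
    and the vertex, whose probabilities are prescribed by uniformity. *)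
Lemma integral_uniform_vertex (R : realType) (d : measure_display)
    (T : measurableType d) (P : probability T R) (n : nat)
    (G : T -> sgraph 'I_n.+1) (o : T -> 'I_n.+1)
    (Phi : sgraph 'I_n.+1 -> 'I_n.+1 -> R) :
    measurable_discrete G -> is_uniform_vertex P G o ->
    (forall g v, 0 <= Phi g v) ->
  (\int[P]_x (Phi (G x) (o x))%:E =
   (graph_mean P G (fun g => n.+1%:R^-1 * \sum_v Phi g v))%:E)%E.
Proof.
move=> mG [mo unif] Phi0.
pose A g v := G @^-1` [set g] `&` o @^-1` [set v].
have mA g v : measurable (A g v) by apply: measurableI.
have -> : (fun x => (Phi (G x) (o x))%:E) =
    (fun x => \sum_g \sum_v (Phi g v)%:E * (\1_(A g v) x)%:E)%E.
  apply/funext => x; rewrite (bigD1 (G x))//= (bigD1 (o x))//=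
    indicE mem_set// mule1.
  rewrite big1 ?adde0; last first.
    by move=> v vo; rewrite indicE memNset ?mule0// => -[_ /= ov];
      rewrite ov eqxx in vo.
  rewrite big1 ?adde0// => g gG; rewrite big1// => v _.
  by rewrite indicE memNset ?mule0// => -[/= gG' _]; rewrite gG' eqxx in gG.
have mPhi g v : measurable_fun setT (fun x => (Phi g v)%:E * (\1_(A g v) x)%:E)%E.
  by apply: measurable_EFin_comp; apply: measurable_funM => //;
    exact: measurable_indic.
have Phi_ge0 g v x : (0 <= (Phi g v)%:E * (\1_(A g v) x)%:E)%E.
  by rewrite mule_ge0// lee_fin.
rewrite ge0_integral_sum//; last 2 first.
- by move=> g; apply: emeasurable_sum => v; exact: mPhi.
- by move=> g x _; apply: sume_ge0 => v _; exact: Phi_ge0.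
rewrite /graph_mean -sumEFin; apply: eq_bigr => g _.
rewrite ge0_integral_sum//.
rewrite mulrCA !mulr_sumr -sumEFin; apply: eq_bigr => v _.
rewrite ge0_integralZl_EFin//; last by apply: measurable_EFin_comp;
  exact: measurable_indic.
rewrite integral_indic//= setIT /A unif card_ord.
rewrite -{1}(fineK (fin_num_measure P _ (mG g))) -!EFinM; congr EFin; ring.
Qed.

Lemma graph_event_mean (R : realType) (d : measure_display)
    (T : measurableType d) (P : probability T R) (n : nat)
    (G : T -> sgraph 'I_n.+1) (o : T -> 'I_n.+1) (D : pred (sgraph 'I_n.+1)) :
    measurable_discrete G -> is_uniform_vertex P G o ->
  P [set x | D (G x)] = (graph_mean P G (fun g => (D g)%:R))%:E.
Proof.
move=> mG ou; have := integral_uniform_vertex mG ou (Phi := fun g v => (D g)%:R)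
  (fun _ _ => ler0n _ _).
have -> : (fun g => n.+1%:R^-1 * \sum_(v < n.+1) (D g)%:R) = (fun g => (D g)%:R :
  R).
  apply/funext => g; rewrite sumr_const card_ord -[X in _ * X]mulr_natl mulrA
    mulVf ?mul1r//.
move=> <-; have mD : measurable [set x | D (G x)].
  rewrite (_ : [set x | _] = \bigcup_(g in [set g | D g]) G @^-1` [set g]).
    apply: fin_bigcup_measurable; first exact: finite_finset.
    by move=> g _; exact: mG.
  apply/seteqP; split => [x Dx|x [g Dg] /= ->//].
  by exists (G x).
have -> : P [set x | D (G x)] = (\int[P]_x (\1_[set x | D (G x)] x)%:E)%E.
  by rewrite integral_indic// setIT.
apply: eq_integral => x _; congr EFin.
rewrite indicE; have [Dx|Dx] := boolP (D (G x)); first by rewrite mem_set.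
by rewrite memNset//; exact/negP.
Qed.

(** The square arises because a vertex of degree d is the target of d arcs, each weighted by at most
    d. *)
Definition degree_tail (R : realType) (n L : nat) (g : sgraph 'I_n.+1) : R :=
  n.+1%:R^-1 * \sum_v (degree g v)%:R ^+ 2 * (L < degree g v)%N%:R.

Lemma uniformly_integrable_tail (R : realType) (d : nat -> measure_display)
    (T : forall n, measurableType (d n)) (P : forall n, probability (T n) R)
    (G : forall n, T n -> sgraph 'I_n.+1) (o : forall n, T n -> 'I_n.+1) (eps : R) :
    (forall n, measurable_discrete (G n)) ->
    (forall n, is_uniform_vertex (P n) (G n) (o n)) ->
    uniformly_integrable P (fun n x => (degree (G n x) (o n x))%:R ^+ 2) ->
      0 < eps ->
  exists L : nat, forall n, graph_mean (P n) (G n) (@degree_tail R n L) <= eps.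
Proof.
move=> mG ou [mX ui] eps0.
have [fin /cvgrPdist_le/(_ _ eps0) dist] := (fine_cvgP _ _).1 ui.
have [M [_ hM]] := filterI fin dist.
(* The uniformly integrable variable is the squared degree, so its cut-off is taken as a square: d^2
   > L^2 means d > L. *)
have [L ML] : exists L : nat, M < L%:R ^+ 2.
  exists (Num.trunc M).+1; apply: lt_le_trans (Num.Theory.truncnS_gt M) _.
  by rewrite -natrX ler_nat expnS expn1 leq_pmulr.
exists L => n; have [] := hM _ ML; set S := ereal_sup _.
rewrite /= sub0r normrN => finS distS.
have Seps : (S <= eps%:E)%E.
  by rewrite -(fineK finS) lee_fin; apply: le_trans (ler_norm _) distS.
rewrite -lee_fin -(integral_uniform_vertex (mG n) (ou n)); last first.
  by move=> g v; rewrite mulr_ge0 ?sqr_ge0.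
apply: le_trans Seps; apply: ereal_sup_ubound; exists n; first exact: Logic.I.
rewrite integral_mkcond; apply: eq_integral => x _.
have E : (x \in [set x | (L%:R ^+ 2 < `|(degree (G n x) (o n x))%:R ^+ 2 : R|)%R]) =
    (L < degree (G n x) (o n x))%N.
  have Ed : (L%:R ^+ 2 < `|(degree (G n x) (o n x))%:R ^+ 2 : R|) =
      (L < degree (G n x) (o n x))%N.
    by rewrite ger0_norm ?sqr_ge0// -!natrX ltr_nat ltn_sqr.
  by apply/idP/idP; rewrite inE -Ed.
rewrite /patch E ger0_norm ?sqr_ge0//.
by case: ltnP => _; rewrite ?mulr1 ?mulr0.
Qed.

(** * The average nearest neighbour degree *)

Section ArcSums.
Variables (R : realType) (n : nat).
Implicit Types (g : sgraph 'I_n) (c : nat -> R).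

(** The weight c(l) = l gives the numerator of the ANND and c = 1 its denominator, so one limit
    statement serves both. *)
Definition arc_sum k c g : R :=
  \sum_(e in arcs g) (degree g e.1 == k)%:R * c (degree g e.2).

Lemma arc_degree_gt0 g e : e \in arcs g -> (0 < degree g e.2)%N.
Proof.
by case: e => u v uv; apply/card_gt0P; exists u; rewrite inE /= arcsC.
Qed.

Lemma sum_arc_target g (F : 'I_n -> R) :
  \sum_(e in arcs g) F e.2 = \sum_v (degree g v)%:R * F v.
Proof.
transitivity (\sum_u \sum_v (if (u, v) \in arcs g then F v else 0)).
  by rewrite pair_big big_mkcond; apply: eq_bigr => -[u v].
rewrite exchange_big /=; apply: eq_bigr => v _.
rewrite -big_mkcond /= sumr_const mulr_natl; congr (_ *+ _).
by apply: eq_card => u; rewrite !inE arcsC.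
Qed.

Lemma sum_degree_indicator (N d : nat) (c : nat -> R) :
  \sum_(1 <= l < N) c l * (d == l)%:R = (0 < d < N)%N%:R * c d.
Proof.
have [dN|dN] := boolP (0 < d < N)%N.
  rewrite mul1r (bigD1_seq d) ?mem_index_iota ?iota_uniq//=
    eqxx mulr1 big1 ?addr0//.
  by move=> l; rewrite eq_sym => /negbTE ->; rewrite mulr0.
rewrite mul0r big_seq big1// => l; rewrite mem_index_iota.
by have [<-|_ _] := eqVneq d l; [rewrite (negbTE dN)|rewrite mulr0].
Qed.

(** The normalisation by the number of arcs cancels. Cutting the sum over l loses nothing, as the
    target of an arc has degree between 1 and the number of vertices minus 1. In the degenerate
    cases both sides are 0 because division by 0 returns 0. *)
Lemma annd_arc_sum g k :
  annd R g k.+1 = arc_sum k.+1 (fun l => l%:R) g / arc_sum k.+1 (fun=> 1) g.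
Proof.
rewrite /annd /arc_degree_freq /arc_joint_degree_freq.
have -> : \sum_(1 <= l < #|'I_n|) l%:R * (#|arcs g|%:R^-1 *
    \sum_(e in arcs g) ((degree g e.1 == k.+1) && (degree g e.2 == l))%:R) =
    #|arcs g|%:R^-1 * arc_sum k.+1 (fun l => l%:R) g :> R.
  under eq_bigr do rewrite mulrCA mulr_sumr.
  rewrite -mulr_sumr exchange_big /=; congr (_ * _); apply: eq_bigr => e eg.
  transitivity ((degree g e.1 == k.+1)%:R * \sum_(1 <= l < #|'I_n|)
      l%:R * (degree g e.2 == l)%:R : R).
    by rewrite mulr_sumr; apply: eq_bigr => l _; rewrite mulrCA; congr (_ * _);
      rewrite -natrM mulnb.
  by rewrite sum_degree_indicator arc_degree_gt0//= degree_lt_card mul1r.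
have -> : \sum_(e in arcs g) (degree g e.1 == k.+1)%:R = arc_sum k.+1 (fun=> 1) g.
  by apply: eq_bigr => e _; rewrite mulr1.
have [M0|M0] := eqVneq (arcs g) finset.set0.
  by rewrite /arc_sum M0 !big_set0 !(mulr0, mul0r).
have -> : #|arcs g|%:R^-1 * arc_sum k.+1 (fun l => l%:R) g /
    (#|arcs g|%:R^-1 * arc_sum k.+1 (fun=> 1) g) =
    arc_sum k.+1 (fun l => l%:R) g / arc_sum k.+1 (fun=> 1) g.
  by rewrite -mulf_div divff ?mul1r// invr_eq0 pnatr_eq0 cards_eq0.
have [_|f0] := ltP 0 (degree_freq R g k.+1); first by rewrite mul1r.
rewrite mul0r; suff -> : arc_sum k.+1 (fun=> 1) g = 0 by rewrite invr0 mulr0.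
apply: big1 => e _; have [ek|_] := eqVneq (degree g e.1) k.+1;
  last by rewrite mul0r.
move: f0; rewrite leNgt => /negP; case; rewrite mulr_gt0//.
  by rewrite invr_gt0 ltr0n; apply/card_gt0P; exists e.1.
rewrite (bigD1 e.1)//= ek eqxx ltr_pwDl// sumr_ge0// => v _; exact: ler0n.
Qed.

Lemma degree_pairs_arc_sum g k (c : nat -> R) L :
  \sum_(l < L) c l.+1 * (degree_pairs k l.+1 g)%:R =
  \sum_(e in arcs g) (degree g e.1 == k)%:R *
    ((0 < degree g e.2 < L.+1)%N%:R * c (degree g e.2)).
Proof.
rewrite -(big_mkord xpredT (fun l => c l.+1 * (degree_pairs k l.+1 g)%:R)).
rewrite -(big_add1 _ _ 0 L.+1 xpredT (fun l => c l * (degree_pairs k l g)%:R)).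
under eq_bigr do rewrite /degree_pairs natr_sum mulr_sumr.
rewrite exchange_big /=; apply: eq_bigr => e _.
rewrite -sum_degree_indicator mulr_sumr; apply: eq_bigr => l _.
by rewrite mulrCA; congr (_ * _); rewrite -natrM mulnb.
Qed.

End ArcSums.

Section ArcSumsTail.
Variables (R : realType) (n : nat).
Implicit Types (g : sgraph 'I_n.+1) (c : nat -> R).

(** Only arcs with target degree above [L] are missing from the finite sum; counting them by target
    turns the weight d into d^2. *)
Lemma arc_sum_tail g k c L : (forall l, (0 < l)%N -> 0 <= c l <= l%:R) ->
  `|n.+1%:R^-1 * arc_sum k c g -
    \sum_(l < L) c l.+1 * (n.+1%:R^-1 * (degree_pairs k l.+1 g)%:R)|
  <= degree_tail R L g.
Proof.
move=> hc; under eq_bigr do rewrite mulrCA.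
rewrite -mulr_sumr degree_pairs_arc_sum -mulrBr /arc_sum -sumrB.
rewrite normrM ger0_norm// ler_wpM2l//; apply: le_trans (ler_norm_sum _ _ _) _.
rewrite [leRHS](_ : _ = \sum_(e in arcs g)
    (degree g e.2)%:R * (L < degree g e.2)%N%:R); last first.
  rewrite (sum_arc_target g (fun v => (degree g v)%:R * (L < degree g v)%N%:R)).
  by apply: eq_bigr => v _; rewrite mulrA.
apply: ler_sum => e eg; have d0 := arc_degree_gt0 eg.
have /andP[c0 cl] := hc _ d0; rewrite d0/= ltnS; case: leqP => _.
  by rewrite mul1r subrr normr0 mulr0.
rewrite mul0r mulr0 subr0 mulr1; case: (_ == k); rewrite ?mul0r ?normr0 ?ler0n//.
by rewrite mul1r ger0_norm.
Qed.

Lemma degree_pairs_square_sum g L :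
  \sum_(k < L) \sum_(l < L) l.+1%:R * (degree_pairs k.+1 l.+1 g)%:R <=
  \sum_v (degree g v)%:R ^+ 2 :> R.
Proof.
under eq_bigr do rewrite (degree_pairs_arc_sum g _ (fun l => l%:R)).
rewrite exchange_big /= -(sum_arc_target g (fun v => (degree g v)%:R)).
apply: ler_sum => e _; rewrite -mulr_suml.
have -> : \sum_(k < L) (degree g e.1 == k.+1)%:R =
    (0 < degree g e.1 < L.+1)%N%:R :> R.
  rewrite -[RHS]mulr1 -(sum_degree_indicator _ _ (fun=> 1)) big_add1 big_mkord.
  by apply: eq_bigr => l _; rewrite mul1r.
by do 2 case: (_ && _); rewrite ?mul1r ?mul0r ?ler0n.
Qed.

Lemma degree_tail_anti g L L' : (L <= L')%N -> degree_tail R L' g <=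
  degree_tail R L g.
Proof.
move=> LL'; rewrite ler_wpM2l//; apply: ler_sum => v _.
rewrite ler_wpM2l ?sqr_ge0// ler_nat; case: (ltnP L' _) => // L'd.
by rewrite (leq_ltn_trans LL' L'd).
Qed.

Lemma square_sum_tail g L :
  n.+1%:R^-1 * \sum_v (degree g v)%:R ^+ 2 <= L%:R ^+ 2 + degree_tail R L g.
Proof.
have N0 : 0 < n.+1%:R :> R by rewrite ltr0n.
rewrite -lerBlDr -mulrBr -sumrB mulrC ler_pdivrMr//.
rewrite [leRHS](_ : _ = \sum_(v < n.+1) L%:R ^+ 2); last first.
  by rewrite sumr_const card_ord -[RHS]mulr_natr.
apply: ler_sum => v _; case: ltnP => dL; first by rewrite mulr1 subrr sqr_ge0.
by rewrite mulr0 subr0 lerXn2r ?nnegrE ?ler0n// ler_nat.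
Qed.

End ArcSumsTail.

(** A pointwise form of Markov's inequality. Either y is at distance at least a/2 from a, which
    includes y = 0 and makes the first term at least 1, or y > a/2 and then |x - c y| is at least e
    a/2. *)
Lemma ratio_deviation (R : realFieldType) (x y a c e : R) :
    0 < a -> 0 < e -> 0 <= c ->
  (e < `|x / y - c|)%R%:R <=
  2 / a * `|y - a| + 2 / (e * a) * (`|x - a * c| + c * `|y - a|).
Proof.
move=> a0 e0 c0; have ea : 0 < e * a by rewrite mulr_gt0.
have [ai eai] : 0 <= 2 / a /\ 0 <= 2 / (e * a) by rewrite !divr_ge0 ?ltW.
have t1 : 0 <= 2 / a * `|y - a| by rewrite mulr_ge0.
have t2 : 0 <= 2 / (e * a) * (`|x - a * c| + c * `|y - a|).
  by rewrite mulr_ge0// addr_ge0// mulr_ge0.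
have [far|_] := boolP (e < _); last exact: addr_ge0.
have [ya|ya] := leP (a / 2) `|y - a|.
  apply: ler_wpDr => //; have := ler_wpM2l ai ya.
  by rewrite mulrA divfK ?gt_eqF// divff.
apply: ler_wpDl => //.
have y0 : a / 2 < y by move: ya; rewrite ltr_distlC; lra.
have yp : 0 < y by apply: lt_trans y0; rewrite divr_gt0.
have : e * (a / 2) <= `|x - a * c| + c * `|y - a|.
  have dev : `|x / y - c| * y = `|x - c * y|.
    rewrite -{2}(gtr0_norm yp) -normrM mulrBl divfK ?gt_eqF//.
  apply: (@le_trans _ _ `|x - c * y|).
    rewrite -dev; apply: ler_pM; rewrite ?ltW ?divr_gt0//.
  have -> : x - c * y = (x - a * c) - c * (y - a) by ring.
  by rewrite (le_trans (ler_normB _ _))// normrM (ger0_norm c0).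
move=> /(ler_wpM2l eai); have -> // : 2 / (e * a) * (e * (a / 2)) = 1.
by field; rewrite !gt_eqF.
Qed.

Unset Implicit Arguments.

(** * From pair counts to the ANND, and finiteness of the second moment *)

Section Convergence.
Variables (R : realType) (d0 : measure_display) (T0 : measurableType d0)
  (P0 : probability T0 R) (W : {RV P0 >-> R}).
Hypotheses (W_ge0 : forall x, 0 <= W x) (EW_gt0 : (0 < 'E_P0[W])%E)
  (EW_fin : ('E_P0[W] < +oo)%E).
Variables (d : nat -> measure_display) (T : forall n, measurableType (d n))
  (P : forall n, probability (T n) R) (G : forall n, T n -> sgraph 'I_n.+1)
  (o : forall n, T n -> 'I_n.+1).
Hypotheses (G_irg : forall n, is_irg W (P n) (G n))
  (o_unif : forall n, is_uniform_vertex (P n) (G n) (o n))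
  (deg2_ui : uniformly_integrable P
     (fun n x => (degree (G n x) (o n x))%:R ^+ 2)).

Set Implicit Arguments.

Let m := fine 'E_P0[W].
Let a k := size_biased W k.
Let gmean n (f : sgraph 'I_n.+1 -> R) := graph_mean (P n) (G n) f.

Let m_gt0 : 0 < m. Proof. exact: mean_weight_gt0. Qed.
Let a_gt0 k : 0 < a k. Proof. exact: size_biased_gt0. Qed.
Let mG n : measurable_discrete (G n). Proof. by case: (G_irg n). Qed.

Let gmean_ge0 n (f : sgraph 'I_n.+1 -> R) : (forall g, 0 <= f g) -> 0 <= gmean f.
Proof. by move=> f0; apply: sumr_ge0 => g _; rewrite mulr_ge0// fine_ge0. Qed.

Let gmean_cst n (r : R) : gmean (fun _ : sgraph 'I_n.+1 => r) = r.
Proof.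
have := graph_event_mean xpredT (@mG n) (o_unif n).
rewrite (_ : [set x | _] = setT); last by apply/seteqP; split.
move=> E; have [g1] := etrans (esym (probability_setT (P n))) E.
rewrite (_ : (fun=> r) = (fun g => r * (xpredT g)%:R)); last first.
  by apply/funext => g; rewrite mulr1.
by rewrite /gmean graph_meanZ -g1 mulr1.
Qed.

Let pairs_near k l (eps : R) : 0 < eps -> \forall n \near \oo,
  gmean (fun g : sgraph 'I_n.+1 => `|n.+1%:R^-1 * (degree_pairs k.+1 l.+1 g)%:R -
    a k * a l / m|) <= eps.
Proof.
move=> eps0; have [n0 h] := degree_pairs_limit W_ge0 EW_gt0 EW_fin k l eps0.
by exists n0 => // n n0n; apply: h.
Qed.

Let tail (eps : R) : 0 < eps ->
  exists L : nat, forall n, gmean (@degree_tail R n L) <= eps.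
Proof. exact: uniformly_integrable_tail. Qed.

Lemma size_biased_total : \sum_(0 <= k < n) a k @[n --> \oo] --> m.
Proof.
have h : ((\sum_(0 <= k < n) (1 * a k))%:E @[n --> \oo] --> m%:E)%E.
  rewrite -(fine_EW EW_gt0 EW_fin).
  have -> : ('E_P0[W] = \int[P0]_x (W x * 1)%:E)%E.
    by rewrite unlock; apply: eq_integral => x _; rewrite mulr1.
  apply: (size_biased_sum_cvg W_ge0 EW_fin (c := fun=> 1) (s := fun=> 1)) => //.
  move=> y _; under eq_fun do under eq_bigr do rewrite mul1r.
  exact: poi_sum_cvg.
apply: cvg_trans (fine_cvg h); apply: near_eq_cvg; apply: nearW => n /=.
by apply: eq_bigr => k _; rewrite mul1r.
Qed.

(** Three errors of eps/3: arcs with large target degree, finitely many pair counts, and the tail of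
    the limiting series. *)
Lemma arc_sum_limit (c : nat -> R) (s : R) k (eps : R) :
    (forall l, (0 < l)%N -> 0 <= c l <= l%:R) -> 0 <= s ->
    \sum_(0 <= l < n) c l.+1 * a l @[n --> \oo] --> s -> 0 < eps ->
  \forall n \near \oo, gmean (fun g : sgraph 'I_n.+1 =>
    `|n.+1%:R^-1 * arc_sum k.+1 c g - a k * (s / m)|) <= eps.
Proof.
move=> hc s0 cs eps0; have e3 : 0 < eps / 3 by rewrite divr_gt0.
have [L1 hL1] := tail e3.
have am0 : 0 < a k / m by rewrite divr_gt0.
have dl0 : 0 < eps / 3 / (a k / m) by rewrite divr_gt0.
have [L2 _ hL2] : \forall n \near \oo,
    `|s - \sum_(0 <= l < n) c l.+1 * a l| <= eps / 3 / (a k / m).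
  by move/cvgrPdist_le: cs; exact.
(* The cut-off must serve both tails; enlarging it only decreases [degree_tail]. *)
pose L := maxn L1 L2.
pose SL := \sum_(l < L) c l.+1.
have SL0 : 0 <= SL by apply: sumr_ge0 => l _; have /andP[] := hc l.+1 isT.
have S1 : 0 < 1 + SL by rewrite ltr_pwDl.
(* The accuracy asked of each pair count: weighted by the c(l + 1), whose sum is [SL], the errors
   stay below eps/3. *)
have del0 : 0 < eps / 3 / (1 + SL) by rewrite divr_gt0.
have : \forall n \near \oo, forall l : 'I_L, gmean (fun g : sgraph 'I_n.+1 =>
    `|n.+1%:R^-1 * (degree_pairs k.+1 l.+1 g)%:R - a k * a l / m|) <=
      eps / 3 / (1 + SL).
  by apply: filter_forall => l; exact: pairs_near.
apply: filterS => n hl.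
pose D l (g : sgraph 'I_n.+1) :=
  `|n.+1%:R^-1 * (degree_pairs k.+1 l.+1 g)%:R - a k * a l / m|.
have pointwise g : `|n.+1%:R^-1 * arc_sum k.+1 c g - a k * (s / m)| <=
    degree_tail R L1 g + (\sum_(l < L) c l.+1 * D l g + eps / 3).
  apply: le_trans (ler_distD (\sum_(l < L) c l.+1 *
    (n.+1%:R^-1 * (degree_pairs k.+1 l.+1 g)%:R)) _ _) _; apply: lerD.
    by apply: le_trans (arc_sum_tail g _ _ hc) (degree_tail_anti _ _ (leq_maxl _
      _)).
  apply: le_trans (ler_distD (\sum_(l < L) c l.+1 * (a k * a l / m)) _ _) _.
  apply: lerD.
    rewrite -sumrB; apply: le_trans (ler_norm_sum _ _ _) _; apply: ler_sum => l _.
    by rewrite -mulrBr normrM ger0_norm//; have /andP[] := hc l.+1 isT.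
  have -> : \sum_(l < L) c l.+1 * (a k * a l / m) = a k / m * \sum_(0 <= l < L)
    c l.+1 * a l.
    by rewrite big_mkord mulr_sumr; apply: eq_bigr => l _; ring.
  have -> : a k * (s / m) = a k / m * s by rewrite mulrA mulrAC.
  rewrite -mulrBr normrM gtr0_norm// mulrC -ler_pdivlMr// distrC.
  by apply: hL2; rewrite /= leq_maxr.
rewrite /gmean; apply: le_trans (le_graph_mean (P n) (G n) pointwise) _.
rewrite graph_meanD graph_meanD graph_mean_sum.
rewrite -[X in _ + (_ + X)]/(gmean (fun=> eps / 3)) gmean_cst.
have h1 := hL1 n.
have h2 : \sum_(l < L) graph_mean (P n) (G n) (fun h => c l.+1 * D l h) <= eps / 3.
  apply: (@le_trans _ _ (\sum_(l < L) c l.+1 * (eps / 3 / (1 + SL)))).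
    apply: ler_sum => l _; rewrite graph_meanZ ler_wpM2l//.
      by have /andP[] := hc l.+1 isT.
    exact: hl.
  rewrite -mulr_suml -/SL mulrCA; apply: ler_piMr; first exact: ltW.
  by rewrite ler_pdivrMr// mul1r lerDr.
move: h1 h2; rewrite /gmean; lra.
Qed.

(* Weighting N(k,l) by l gives at most the sum of the squared degrees, which
   bounds the limits a k * a l weighted over squares; the sum of the a k alone is
   eventually at least m / 2 and can be divided out. *)
Lemma size_biased_moment_bounded :
  exists C : R, forall n, \sum_(0 <= l < n) l.+1%:R * a l <= C.
Proof.
have [K0 hK0] := tail ltr01.
(* K0^2 bounds the squares of degrees at most K0; one unit covers the tail beyond K0 and the other
   the deviations of the pair counts. *)
pose C0 : R := K0%:R ^+ 2 + 2.
have square L : (\sum_(0 <= k < L) a k) / m * (\sum_(0 <= l < L) l.+1%:R * a l)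
  <= C0.
  pose S : R := \sum_(k < L) \sum_(l < L) l.+1%:R.
  have S0 : 0 <= S by apply: sumr_ge0 => k _; apply: sumr_ge0.
  have S1 : 0 < 1 + S by rewrite ltr_pwDl.
  have del0 : 0 < (1 + S)^-1 by rewrite invr_gt0.
  (* One good n is enough: the quantity to be bounded is deterministic and free of n. *)
  have [n hn] : exists n, forall kl : 'I_L * 'I_L, gmean (fun g : sgraph 'I_n.+1 =>
      `|n.+1%:R^-1 * (degree_pairs kl.1.+1 kl.2.+1 g)%:R - a kl.1 * a kl.2 / m|)
        <= (1 + S)^-1.
    have : \forall n \near \oo, forall kl : 'I_L * 'I_L,
      gmean (fun g : sgraph 'I_n.+1 =>
      `|n.+1%:R^-1 * (degree_pairs kl.1.+1 kl.2.+1 g)%:R - a kl.1 * a kl.2 / m|)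
        <= (1 + S)^-1.
      by apply: filter_forall => kl; exact: pairs_near.
    by case=> n _ h; exists n; apply: h => /=.
  pose D (k l : 'I_L) (g : sgraph 'I_n.+1) :=
    `|n.+1%:R^-1 * (degree_pairs k.+1 l.+1 g)%:R - a k * a l / m|.
  have pointwise g : (\sum_(0 <= k < L) a k) / m * (\sum_(0 <= l < L)
    l.+1%:R * a l) <=
      K0%:R ^+ 2 + (degree_tail R K0 g + \sum_(k < L) \sum_(l < L)
        l.+1%:R * D k l g).
    rewrite addrA.
    apply: (@le_trans _ _ (n.+1%:R^-1 * (\sum_(k < L) \sum_(l < L)
        l.+1%:R * (degree_pairs k.+1 l.+1 g)%:R) +
        \sum_(k < L) \sum_(l < L) l.+1%:R * D k l g)); last first.
      rewrite lerD2r; apply: le_trans (square_sum_tail R g K0).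
      by rewrite ler_wpM2l// degree_pairs_square_sum.
    rewrite !big_mkord [X in _ <= X + _]mulr_sumr -big_split /= !mulr_suml.
    apply: ler_sum => k _; rewrite !mulr_sumr -big_split /=.
    apply: ler_sum => l _.
    rewrite [X in _ <= X + _]mulrCA -mulrDr mulrCA ler_wpM2l// mulrAC.
    by rewrite -lerBlDl /D distrC; exact: ler_norm.
  have := le_graph_mean (P n) (G n) pointwise.
  rewrite -/(gmean _) gmean_cst => /le_trans; apply.
  rewrite graph_meanD graph_meanD -[X in X + _]/(gmean (fun=> K0%:R ^+ 2))
    gmean_cst /C0.
  rewrite lerD2l -[leRHS]/(1 + 1); apply: lerD; first exact: hK0.
  rewrite graph_mean_sum; apply: (@le_trans _ _ (\sum_(k < L) \sum_(l < L)
    l.+1%:R * (1 + S)^-1)).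
    apply: ler_sum => k _; rewrite graph_mean_sum; apply: ler_sum => l _.
    by rewrite graph_meanZ ler_wpM2l//; exact: (hn (k, l)).
  under eq_bigr do rewrite -mulr_suml.
  by rewrite -mulr_suml -/S ler_pdivrMr// mul1r lerDr.
have [L0 _ hL0] : \forall n \near \oo, m / 2 <= \sum_(0 <= k < n) a k.
  have m2 : m / 2 < m by rewrite ltr_pdivrMr// ltr_pMr// ltr1n.
  by move/cvgr_gt: size_biased_total => /(_ _ m2); apply: filterS => n /ltW.
have mono p q : (p <= q)%N ->
    \sum_(0 <= l < p) l.+1%:R * a l <= \sum_(0 <= l < q) l.+1%:R * a l.
  move=> pq; rewrite (big_cat_nat (leq0n p) pq)//= lerDl.
  by apply: sumr_ge0 => l _; rewrite mulr_ge0// ltW.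
exists (2 * C0) => n; apply: le_trans (mono _ _ (leq_maxl n L0)) _.
have := square (maxn n L0); have := hL0 (maxn n L0) (leq_maxr _ _).
set A := \sum_(0 <= k < _) a k; set B := \sum_(0 <= l < _) _ => hA hB.
have B0 : 0 <= B by apply: sumr_ge0 => l _; rewrite mulr_ge0// ltW.
have half : 1 / 2 <= A / m by rewrite ler_pdivlMr//; lra.
have := ler_wpM2r B0 half; lra.
Qed.

Let m2 : \bar R := ('E_P0[fun x => (W x ^+ 2)%R])%E.

Let m2_ge0 : (0 <= m2)%E.
Proof. by apply: expectation_ge0 => x; exact: sqr_ge0. Qed.

Let moment_integral : (\int[P0]_x (W x * (1 + W x))%:E = m%:E + m2)%E.
Proof.
rewrite -(fine_EW EW_gt0 EW_fin) /m2 !unlock -ge0_integralD//; first last.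
- by apply: measurable_EFin_comp; apply: measurable_funX; exact: measurable_funPT.
- by move=> x _; rewrite lee_fin sqr_ge0.
- by apply: measurable_EFin_comp; exact: measurable_funPT.
- by move=> x _; rewrite lee_fin.
by apply: eq_integral => x _; rewrite -EFinD mulrDr mulr1 expr2.
Qed.

Let moment_cvg : ((\sum_(0 <= l < n) l.+1%:R * a l)%:E @[n --> \oo] -->
  m%:E + m2)%E.
Proof.
rewrite -moment_integral.
apply: (size_biased_sum_cvg W_ge0 EW_fin (c := fun l => l.+1%:R) (s := fun y =>
  1 + y)) => //.
by move=> y _; exact: poi_mean_sum_cvg.
Qed.

(** The bounded partial sums converge in the extended reals to m + E[W^2], which therefore obeys the
    same bound. *)
Lemma second_moment_fin : (m2 < +oo)%E.
Proof.
have [C hC] := size_biased_moment_bounded.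
have : (m%:E + m2 <= C%:E)%E.
  rewrite -(cvg_lim _ moment_cvg)//; apply: lime_le; first exact: cvgP moment_cvg.
  by apply: nearW => n; rewrite lee_fin.
move=> h; apply: le_lt_trans (ltry C); apply: le_trans h.
by rewrite leeDr// lee_fin ltW.
Qed.

Lemma size_biased_moment : \sum_(0 <= l < n) l.+1%:R * a l @[n --> \oo] -->
  m + fine m2.
Proof.
suff h : ((\sum_(0 <= l < n) l.+1%:R * a l)%:E @[n --> \oo] --> (m + fine m2)%:E)%E.
  exact: fine_cvg h.
rewrite EFinD (fineK (x := m2)); first exact: moment_cvg.
by rewrite ge0_fin_numE// second_moment_fin.
Qed.

(** Numerator and denominator carry the same factor [a k], which cancels; hence the limit is the
    same for all degrees. *)
Lemma annd_cvg_in_probability k :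
  cvg_in_probability P (fun n x => annd R (G n x) k.+1) (1 + fine m2 / m).
Proof.
move=> e e0; set s := 1 + fine m2 / m.
have fm2 : 0 <= fine m2 by exact: fine_ge0.
have sE : s = (m + fine m2) / m by rewrite mulrDl divff ?gt_eqF.
have s0 : 0 <= s by rewrite sE; exact: divr_ge0 (addr_ge0 (ltW m_gt0) fm2)
  (ltW m_gt0).
have prob n : P n [set x | (e < `|annd R (G n x) k.+1 - s|)%R] =
    (gmean (fun g : sgraph 'I_n.+1 => (e < `|annd R g k.+1 - s|)%R%:R))%:E.
  exact: (graph_event_mean (fun g => (e < `|annd R g k.+1 - s|)%R) (@mG n)
    (o_unif n)).
under eq_fun do rewrite prob.
apply: cvg_EFin; first exact: nearW.
apply/cvgrPdist_le => eps eps0.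
have ea : 0 < e * a k by rewrite mulr_gt0.
(* [c1] and [c2] are the coefficients in [ratio_deviation] of the denominator error and of the
   numerator error. *)
pose c1 := 2 / a k + 2 / (e * a k) * s.
pose c2 := 2 / (e * a k).
have c20 : 0 < c2 by rewrite divr_gt0.
have c10 : 0 < c1 by rewrite ltr_pwDl ?divr_gt0// mulr_ge0// ltW.
have d1 : 0 < eps / 2 / c1 by rewrite !divr_gt0.
have d2 : 0 < eps / 2 / c2 by rewrite !divr_gt0.
have total : \sum_(0 <= l < n) 1 * a l @[n --> \oo] --> m.
  by under eq_fun do under eq_bigr do rewrite mul1r; exact: size_biased_total.
have one_le l : (0 < l)%N -> 0 <= (1 : R) <= l%:R by move=> l0; rewrite ler01 ler1n.
have id_le l : (0 < l)%N -> 0 <= (l%:R : R) <= l%:R by rewrite ler0n lexx.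
have hY := arc_sum_limit (c := fun=> 1) k one_le (ltW m_gt0) total d1.
have hX := arc_sum_limit (c := fun l => l%:R) k id_le (addr_ge0 (ltW m_gt0) fm2)
  size_biased_moment d2.
near=> n; have hYn := near hY n; have hXn := near hX n.
rewrite sub0r normrN ger0_norm; last by apply: gmean_ge0 => g; exact: ler0n.
pose X (g : sgraph 'I_n.+1) : R := n.+1%:R^-1 * arc_sum k.+1 (fun l => l%:R) g.
pose Y (g : sgraph 'I_n.+1) : R := n.+1%:R^-1 * arc_sum k.+1 (fun=> 1) g.
have pointwise g : (e < `|annd R g k.+1 - s|)%R%:R <=
    c1 * `|Y g - a k * (m / m)| + c2 * `|X g - a k * ((m + fine m2) / m)|.
  rewrite divff ?gt_eqF// mulr1 -sE annd_arc_sum.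
  have -> : arc_sum k.+1 (fun l => l%:R) g / arc_sum k.+1 (fun=> 1) g = X g / Y g.
    by rewrite /X /Y -mulf_div divff ?mul1r// invr_eq0 pnatr_eq0.
  apply: le_trans (ratio_deviation (X g) (Y g) (a_gt0 k) e0 s0) _.
  by rewrite le_eqVlt; apply/orP; left; apply/eqP; rewrite /c1 /c2; ring.
apply: le_trans (le_graph_mean (P n) (G n) pointwise) _.
rewrite graph_meanD !graph_meanZ.
have -> : eps = c1 * (eps / 2 / c1) + c2 * (eps / 2 / c2).
  by field; rewrite !gt_eqF.
apply: lerD.
  by rewrite ler_pM2l//; exact: hYn.
by rewrite ler_pM2l//; exact: hXn.
Unshelve. all: by end_near. Qed.

End Convergence.

Unset Implicit Arguments.
Set Strict Implicit.

(* For n : nat, [G n] is the graph IRG_{n+1}(W) with n + 1 vertices, so that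
   the index range is n + 1 >= 1.  The first conjunct makes explicit that the
   limit is a real number, since [fine] maps +oo to 0. *)
Theorem proposition3p1 (R : realType)
    (d0 : measure_display) (T0 : measurableType d0) (P0 : probability T0 R)
    (W : {RV P0 >-> R})
    (W_ge0 : forall x, 0 <= W x)
    (EW_gt0 : (0 < 'E_P0[W])%E) (EW_fin : ('E_P0[W] < +oo)%E)
    (d : nat -> measure_display) (T : forall n, measurableType (d n))
    (P : forall n, probability (T n) R)
    (G : forall n, T n -> sgraph 'I_n.+1)
    (G_irg : forall n, is_irg W (P n) (G n))
    (o : forall n, T n -> 'I_n.+1)
    (o_unif : forall n, is_uniform_vertex (P n) (G n) (o n))
    (deg2_ui : uniformly_integrable P
       (fun n x => (degree (G n x) (o n x))%:R ^+ 2)) :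
  ('E_P0[fun x => (W x ^+ 2)%R] < +oo)%E /\
  forall k : nat, (1 <= k)%N ->
    cvg_in_probability P (fun n x => annd R (G n x) k)
      (1 + fine 'E_P0[fun x => (W x ^+ 2)%R] / fine 'E_P0[W]).
Proof.
split; first exact: (second_moment_fin W_ge0 EW_gt0 EW_fin G_irg o_unif deg2_ui).
case=> // k _.
exact: (annd_cvg_in_probability W_ge0 EW_gt0 EW_fin G_irg o_unif deg2_ui k).
Qed.
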